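(* Let $n\ge3$. Every continuous translation invariant and $\mathrm{O}(n)$ equivariant even Minkowski valuation $\Phi:\mathcal{K}^n\to\mathcal{K}^n$ can be approximated uniformly on compact subsets of $\mathcal{K}^n$ by smooth translation invariant and $\mathrm{O}(n)$ equivariant even Minkowski valuations; that is, there exists a sequence $\Phi^m$, $m\in\mathbb{N}$, of smooth translation invariant and $\mathrm{O}(n)$ equivariant even Minkowski valuations which converges to $\Phi$ uniformly on every compact subset of $\mathcal{K}^n$.
   Context: $\mathcal{K}^n$ is the space of convex bodies (non-empty compact convex sets) in $\mathbb{R}^n$, $n\ge3$, with the Hausdorff metric. $h(K,u)=\max\{u\cdot x:x\in K\}$, $u\in S^{n-1}$, is the support function. A map $\Phi:\mathcal{K}^n\to\mathcal{K}^n$ is a Minkowski valuation if $\Phi K+\Phi L=\Phi(K\cup L)+\Phi(K\cap L)$ whenever $K,L,K\cup L\in\mathcal{K}^n$, with Minkowski addition. It is translation invariant if $\Phi(K+x)=\Phi K$ for all $x\in\mathbb{R}^n$; $\mathrm{O}(n)$ equivariant if $\Phi(\vartheta K)=\vartheta\Phi K$ for all $\vartheta\in\mathrm{O}(n)$; even if $\Phi(-K)=\Phi K$ (all for every $K\in\mathcal{K}^n$). Smoothness: fix a point $\bar e\in S^{n-1}$. $\mathbf{Val}$ is the Banach space of continuous translation invariant real-valued valuations on $\mathcal{K}^n$ (maps $\phi$ with $\phi(K\cup L)+\phi(K\cap L)=\phi(K)+\phi(L)$ whenever $K,L,K\cup L\in\mathcal{K}^n$), with norm $\|\phi\|=\sup\{|\phi(K)|:K\subseteq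 B\}$, $B$ the Euclidean unit ball. $\phi\in\mathbf{Val}$ is smooth if the map $\mathrm{GL}(n)\to\mathbf{Val}$, $A\mapsto\phi(A^{-1}\,\cdot\,)$, is infinitely differentiable. A continuous translation invariant $\mathrm{O}(n)$ equivariant Minkowski valuation $\Phi$ is called smooth if its associated real-valued valuation $\varphi(K)=h(\Phi K,\bar e)$ is a smooth element of $\mathbf{Val}$. *)

(* Defs.v *)
From HB Require Import structures.
From mathcomp Require Import all_boot all_order all_algebra.
From mathcomp Require Import all_classical all_reals all_analysis.
From mathcomp Require Import ring lra.
Import Order.TTheory GRing.Theory Num.Theory.
Import numFieldNormedType.Exports.

Set Implicit Arguments.
Unset Strict Implicit.
Unset Printing Implicit Defensive.

Local Open Scope classical_set_scope.
Local Open Scope ring_scope.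

Section max_norm.
Context {R : realType} {m n : nat}.
Implicit Types A : 'M[R]_(m, n).

Lemma mx_coord_le A i j : `|A i j| <= `|A|.
Proof.
have -> : `|A| = mx_norm A by [].
by rewrite mx_normrE (le_bigmax _ (fun ij => `|A ij.1 ij.2|) (i, j)).
Qed.

Lemma mx_norm_le A (c : R) : 0 <= c -> (forall i j, `|A i j| <= c) -> `|A| <= c.
Proof.
move=> c0 Ac; have -> : `|A| = mx_norm A by [].
by rewrite mx_normrE; apply/bigmax_leP; split=> // -[i j] _; exact: Ac.
Qed.

End max_norm.

Section euclidean.
Context {R : realType} {n : nat}.
Implicit Types x y z u : 'cV[R]_n.

Definition dot x y : R := \sum_i x i 0 * y i 0.

(* The norm `|x| that MathComp-Analysis puts on matrices is the maximum norm;
   the geometry below uses the Euclidean one. *)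
Definition enorm x : R := Num.sqrt (dot x x).

Definition unit_ball : set 'cV[R]_n := [set x | enorm x <= 1].

Lemma dotC x y : dot x y = dot y x.
Proof. by apply: eq_bigr => i _; rewrite mulrC. Qed.

Lemma dotDl x y z : dot (x + y) z = dot x z + dot y z.
Proof.
by rewrite /dot -big_split; apply: eq_bigr => i _; rewrite mxE mulrDl.
Qed.

Lemma dotZl (a : R) x y : dot (a *: x) y = a * dot x y.
Proof.
by rewrite /dot mulr_sumr; apply: eq_bigr => i _; rewrite mxE mulrA.
Qed.

Lemma dotDr x y z : dot z (x + y) = dot z x + dot z y.
Proof. by rewrite !(dotC z) dotDl. Qed.

Lemma dotZr (a : R) x y : dot y (a *: x) = a * dot y x.
Proof. by rewrite !(dotC y) dotZl. Qed.

Lemma dot_ge0 x : 0 <= dot x x.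
Proof. by apply: sumr_ge0 => i _; rewrite -expr2 sqr_ge0. Qed.

Lemma enorm_ge0 x : 0 <= enorm x.
Proof. exact: sqrtr_ge0. Qed.

Lemma sqr_enorm x : enorm x ^+ 2 = dot x x.
Proof. by rewrite sqr_sqrtr ?dot_ge0. Qed.

Lemma enorm_le (c : R) x : 0 <= c -> dot x x <= c ^+ 2 -> enorm x <= c.
Proof.
by move=> c0 xc; rewrite -(ger0_norm c0) -sqrtr_sqr ler_sqrt ?sqr_ge0.
Qed.

Lemma enormZ (a : R) x : enorm (a *: x) = `|a| * enorm x.
Proof.
by rewrite /enorm dotZl dotZr mulrA -expr2 sqrtrM ?sqr_ge0// sqrtr_sqr.
Qed.

Lemma enormN x : enorm (- x) = enorm x.
Proof. by rewrite -scaleN1r enormZ normrN1 mul1r. Qed.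

Lemma enormB x y : enorm (x - y) = enorm (y - x).
Proof. by rewrite -enormN opprB. Qed.

Lemma enorm0 : enorm 0 = 0.
Proof. by rewrite -(scale0r 0) enormZ normr0 mul0r. Qed.

Lemma enorm_mx_norm x : enorm x <= n%:R * `|x|.
Proof.
apply: enorm_le; first by rewrite mulr_ge0.
apply: (@le_trans _ _ (\sum_(i < n) `|x| ^+ 2)).
  apply: ler_sum => i _.
  by rewrite -expr2 -real_normK ?num_real// lerXn2r ?nnegrE ?mx_coord_le.
rewrite sumr_const card_ord -[leLHS]mulr_natl exprMn ler_wpM2r ?sqr_ge0//.
by rewrite -natrX ler_nat; case: (n) => // m; rewrite expnS expn1 leq_pmulr.
Qed.

Lemma coord_le_enorm x i : `|x i 0| <= enorm x.
Proof.
rewrite -ler_sqr ?nnegrE ?enorm_ge0// sqr_enorm real_normK ?num_real//.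
rewrite /dot (bigD1 i)//= -expr2 lerDl.
by apply: sumr_ge0 => j _; rewrite -expr2 sqr_ge0.
Qed.

Lemma mx_norm_enorm x : `|x| <= enorm x.
Proof.
apply: mx_norm_le => [|i j]; first exact: enorm_ge0.
by rewrite (ord1 j) coord_le_enorm.
Qed.

Lemma enorm_eq0 x : enorm x = 0 -> x = 0.
Proof.
move=> x0; apply/eqP; rewrite -normr_le0.
by apply: le_trans (mx_norm_enorm x) _; rewrite x0.
Qed.

Lemma dot_cauchy_schwarz x y : `|dot x y| <= enorm x * enorm y.
Proof.
rewrite -ler_sqr ?nnegrE ?mulr_ge0 ?enorm_ge0// real_normK ?num_real//.
rewrite exprMn !sqr_enorm.
have [y0|y0] := eqVneq (dot y y) 0.
  suff -> : y = 0.
    by rewrite dotC -(scale0r 0) !dotZl !mul0r mulr0 expr0n.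
  by apply: enorm_eq0; rewrite /enorm y0 sqrtr0.
have yp : 0 < dot y y by rewrite lt_neqAle eq_sym y0 dot_ge0.
have := dot_ge0 (dot y y *: x + (- dot x y) *: y).
rewrite !(dotDl, dotDr, dotZl, dotZr) (dotC y x) => h.
rewrite -subr_ge0 -(pmulr_rge0 _ yp).
by apply: le_trans h _; rewrite le_eqVlt; apply/orP; left; apply/eqP; ring.
Qed.

Lemma enorm_triangle x y : enorm (x + y) <= enorm x + enorm y.
Proof.
apply: enorm_le; first by rewrite addr_ge0 ?enorm_ge0.
rewrite !(dotDl, dotDr) (dotC y x) -!sqr_enorm.
have := le_trans (ler_norm _) (dot_cauchy_schwarz x y).
by move=> h; nra.
Qed.

Lemma enorm_distD x y z : enorm (x - z) <= enorm (x - y) + enorm (y - z).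
Proof. by rewrite -(subrKA y) enorm_triangle. Qed.

Lemma nbhs_enormP x (P : set 'cV[R]_n) :
  nbhs x P <-> exists2 e : R, 0 < e & [set y | enorm (x - y) < e] `<=` P.
Proof.
split=> [/nbhs_ballP[e /= e0 eP]|[e e0 eP]].
  exists e => // y /= xy; apply: eP.
  by rewrite -ball_normE/=; apply: le_lt_trans xy; exact: mx_norm_enorm.
apply/nbhs_ballP; exists (e / n.+1%:R) => /=; first by rewrite divr_gt0.
move=> y; rewrite -ball_normE/= => xy; apply: eP => /=.
apply: le_lt_trans (enorm_mx_norm _) _.
move: xy; rewrite ltr_pdivlMr// mulrC => /(le_lt_trans _); apply.
by rewrite ler_wpM2r// ler_nat.
Qed.

Lemma enorm_continuous : continuous (enorm : 'cV[R]_n -> R).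
Proof.
move=> x P /nbhs_ballP[e /= e0 eP]; apply/nbhs_enormP; exists e => // y /= xy.
apply: eP; rewrite -ball_normE/= ltr_norml; have := enorm_triangle (x - y) y.
have := enorm_triangle (y - x) x; rewrite !subrK enormB => h1 h2.
by apply/andP; split; lra.
Qed.

Lemma dot_continuous x : continuous (dot x).
Proof.
move=> y P /nbhs_ballP[e /= e0 eP]; apply/nbhs_enormP.
have x0 : 0 < 1 + enorm x by rewrite ltr_pwDl// enorm_ge0.
exists (e / (1 + enorm x)) => [|z /=]; first by rewrite divr_gt0.
rewrite ltr_pdivlMr// => yz; apply: eP; rewrite -ball_normE/=.
have -> : dot x y - dot x z = dot x (y - z).
  by rewrite dotDr -[- z]scaleN1r dotZr mulN1r.
apply: le_lt_trans (dot_cauchy_schwarz _ _) _; apply: le_lt_trans yz.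
by rewrite mulrC ler_wpM2l ?enorm_ge0// lerDr.
Qed.

Lemma closed_enormP (A : set 'cV[R]_n) :
  closed A <->
  forall x, (forall e, 0 < e -> exists2 y, A y & enorm (x - y) < e) -> A x.
Proof.
split=> [cA x h|h].
  apply: cA => B /nbhs_enormP[e e0 eB].
  by have [y Ay xy] := h _ e0; exists y; split=> //; exact: eB.
move=> x clx; apply: h => e e0.
have /clx[y [Ay /= xy]] : nbhs x [set y | enorm (x - y) < e].
  by apply/nbhs_enormP; exists e.
by exists y.
Qed.

End euclidean.

Section compactness.
Context {R : realType} {n : nat}.

Lemma mulmx_enorm_bound (A : 'M[R]_n) :
  exists2 C : R, 0 < C & forall x, enorm (A *m x) <= C * enorm x.
Proof.
exists (n%:R * (n%:R * `|A|) + 1) => [|x]; first by rewrite ltr_wpDl ?mulr_ge0.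
apply: le_trans (enorm_mx_norm _) _.
apply: (@le_trans _ _ (n%:R * (n%:R * `|A| * enorm x))); last first.
  by rewrite mulrA ler_wpM2r ?enorm_ge0// lerDl.
rewrite ler_wpM2l//; apply: mx_norm_le => [|i j].
  by rewrite !mulr_ge0 ?enorm_ge0.
rewrite mxE; apply: le_trans (ler_norm_sum _ _ _) _.
apply: (@le_trans _ _ (\sum_(k < n) `|A| * enorm x)).
  apply: ler_sum => k _; rewrite normrM ler_pM// ?mx_coord_le//.
  by rewrite (ord1 j) coord_le_enorm.
by rewrite sumr_const card_ord -[leLHS]mulr_natl mulrA.
Qed.

Lemma mulmx_continuous (A : 'M[R]_n) :
  continuous (mulmx A : 'cV[R]_n -> 'cV[R]_n).
Proof.
have [C C0 AC] := mulmx_enorm_bound A.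
move=> x P /nbhs_enormP[e e0 eP]; apply/nbhs_enormP.
exists (e / C); first by rewrite divr_gt0.
move=> y /=; rewrite ltr_pdivlMr// mulrC => xy; apply: eP => /=.
by rewrite -mulmxBr; apply: le_lt_trans xy.
Qed.

Lemma closed_enorm_compact (A : set 'cV[R]_n) (M : R) :
  closed A -> (forall x, A x -> enorm x <= M) -> compact A.
Proof.
move=> cA AM.
have ctr p q : continuous (trmx : 'M[R]_(p, q) -> 'M[R]_(q, p)).
  move=> x P /nbhs_ballP[e /= e0 eP]; apply/nbhs_ballP; exists e => // y [_ xy].
  by apply: eP; split=> // i j; rewrite !mxE.
have -> : A = trmx @` ((trmx : 'rV[R]_n -> 'cV[R]_n) @^-1` A).
  rewrite eqEsubset; split=> [x Ax|_ [x Ax <-]//].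
  by exists x^T => /=; rewrite trmxK.
apply: continuous_compact; first exact/continuous_subspaceT/ctr.
apply: bounded_closed_compact; last by apply: closed_comp => // x _; exact: ctr.
exists M; split; first exact: num_real.
move=> r Mr x /= Ax; apply: le_trans (ltW Mr); apply: le_trans (AM _ Ax).
apply: mx_norm_le => [|i j]; first exact: enorm_ge0.
by have := coord_le_enorm x^T j; rewrite mxE (ord1 i).
Qed.

Lemma compact_enorm_bounded (A : set 'cV[R]_n) :
  compact A -> exists M : R, forall x, A x -> enorm x <= M.
Proof.
move=> /compact_bounded[M [_ hM]]; exists (n%:R * (M + 1)) => x Ax.
apply: le_trans (enorm_mx_norm _) _; rewrite ler_wpM2l//.
by apply: hM => //; rewrite ltrDl.
Qed.

Lemma compact_enorm_closed (A : set 'cV[R]_n) : compact A -> closed A.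
Proof. by apply: compact_closed; exact: norm_hausdorff. Qed.

End compactness.

Section convex_bodies.
Context {R : realType} {n : nat}.
Implicit Types (A : 'M[R]_n) (x y : 'cV[R]_n).

Definition is_body (K : set 'cV[R]_n) : Prop :=
  [/\ K !=set0, compact K & convex_set (K : set (convex_lmodType 'cV[R]_n))].

Lemma convex_setP (K : set 'cV[R]_n) :
  convex_set (K : set (convex_lmodType 'cV[R]_n)) <->
  forall x y (t : R), 0 <= t -> t <= 1 -> K x -> K y ->
    K (t *: x + (1 - t) *: y).
Proof.
split=> [cK x y t t0 t1 Kx Ky|cK x y t].
  pose s : {i01 R} := Itv01 t0 t1.
  by have := cK x y s; rewrite !inE => /(_ Kx Ky).
by rewrite !inE => Kx Ky; apply: cK.
Qed.

End convex_bodies.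

Record body (R : realType) (n : nat) := Body {
  body_set :> set 'cV[R]_n;
  bodyP : is_body body_set }.

HB.instance Definition _ (R : realType) (n : nat) := gen_eqMixin (body R n).
HB.instance Definition _ (R : realType) (n : nat) := gen_choiceMixin (body R n).

Section operations.
Context {R : realType} {n : nat}.
Implicit Types (A : 'M[R]_n) (x y : 'cV[R]_n) (K L : body R n).

Lemma body_inj K L : K = L :> set _ -> K = L.
Proof.
by case: K L => [K hK] [L hL] /= KL; subst L; congr Body; exact: Prop_irrelevance.
Qed.

Lemma body_nonempty K : exists x, body_set K x.
Proof. by case: (bodyP K). Qed.

Lemma body_compact K : compact K.
Proof. by case: (bodyP K). Qed.

Lemma body_convex K x y (t : R) :
  0 <= t -> t <= 1 -> body_set K x -> body_set K y ->
  body_set K (t *: x + (1 - t) *: y).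
Proof. by case: (bodyP K) => _ _ /convex_setP; exact. Qed.

Lemma image_is_body (f : 'cV[R]_n -> 'cV[R]_n) K : continuous f ->
  (forall x y t, f (t *: x + (1 - t) *: y) = t *: f x + (1 - t) *: f y) ->
  is_body (f @` K).
Proof.
move=> cf af; split.
- by have [x Kx] := body_nonempty K; exists (f x), x.
- apply: continuous_compact; last exact: body_compact.
  exact: continuous_subspaceT.
- apply/convex_setP => _ _ t t0 t1 [x Kx <-] [y Ky <-].
  by exists (t *: x + (1 - t) *: y); [exact: body_convex|exact: af].
Qed.

Lemma add_is_body K L : is_body [set x + y | x in K & y in L].
Proof.
split.
- have [x Kx] := body_nonempty K; have [y Ly] := body_nonempty L.
  by exists (x + y), x => //; exists y.
- have -> : [set x + y | x in K & y in L] =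
      (fun p : 'cV[R]_n * 'cV[R]_n => p.1 + p.2) @` (K `*` L).
    rewrite eqEsubset; split=> [_ [x Kx [y Ly <-]]|_ [[x y] [/= Kx Ly] <-]].
      by exists (x, y).
    by exists x => //; exists y.
  apply: continuous_compact; last first.
    by apply: compact_setX; exact: body_compact.
  by apply: continuous_subspaceT; exact: add_continuous.
- apply/convex_setP => _ _ t t0 t1 [x Kx [y Ly <-]] [x' Kx' [y' Ly' <-]].
  exists (t *: x + (1 - t) *: x'); first exact: body_convex.
  exists (t *: y + (1 - t) *: y'); first exact: body_convex.
  by rewrite !scalerDr addrACA.
Qed.

Lemma translate_is_body K x : is_body [set y + x | y in K].
Proof.
apply: image_is_body => [y|y z t]; first by apply: (@continuousD _ _ _ id (fun=> x)) => //; exact: cst_continuous.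
by rewrite !scalerDr addrACA -scalerDl [t + _]addrC subrK scale1r.
Qed.

Lemma opp_is_body K : is_body [set - y | y in K].
Proof.
apply: image_is_body => [y|y z t]; first exact: oppr_continuous.
by rewrite opprD !scalerN.
Qed.

Lemma lin_is_body A K : is_body [set A *m y | y in K].
Proof.
apply: image_is_body => [|y z t]; first exact: mulmx_continuous.
by rewrite mulmxDr -!scalemxAr.
Qed.

Definition body_add K L : body R n := Body (add_is_body K L).
Definition body_translate K x : body R n := Body (translate_is_body K x).
Definition body_opp K : body R n := Body (opp_is_body K).
Definition body_lin A K : body R n := Body (lin_is_body A K).

(* [support_max]: the supremum is a maximum. *)
Definition support K x : R := sup [set dot x y | y in K].

Lemma support_max K x :
  exists2 y, body_set K y &
    dot x y = support K x /\ forall z, body_set K z -> dot x z <= dot x y.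
Proof.
have [|y /set_mem Ky ymax] :=
    @compact_EVT_max _ R (dot x) K (body_nonempty K) (@body_compact K).
  exact/continuous_subspaceT/dot_continuous.
have zy z : body_set K z -> dot x z <= dot x y by move=> /mem_set /ymax.
exists y => //; split=> //; apply/eqP; rewrite eq_le; apply/andP; split.
  by apply: ub_le_sup; [exists (dot x y) => _ [z Kz <-]; exact: zy|exists y].
by apply: ge_sup => [|_ [z Kz <-]]; [exists (dot x y), y|exact: zy].
Qed.

End operations.

Arguments body_compact {R n} K.

Section hausdorff_metric.
Context {R : realType} {n : nat}.
Implicit Types (K L M : body R n) (x y : 'cV[R]_n) (e : R).

(* L + eB, for 0 <= e *)
Definition parallel_set (L : set 'cV[R]_n) e : set 'cV[R]_n :=
  [set x | exists2 y, L y & enorm (x - y) <= e].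

Definition hausdorff_dist K L : R :=
  inf [set e | [/\ 0 <= e, K `<=` parallel_set L e & L `<=` parallel_set K e]].

Let hset K L : set R :=
  [set e | [/\ 0 <= e, K `<=` parallel_set L e & L `<=` parallel_set K e]].

Let hset_lb K L : lbound (hset K L) 0.
Proof. by move=> e []. Qed.

Let hset_neq0 K L : hset K L !=set0.
Proof.
have [a aK] := compact_enorm_bounded (body_compact K).
have [b bL] := compact_enorm_bounded (body_compact L).
have [x Kx] := body_nonempty K; have [y Ly] := body_nonempty L.
have ab u v : body_set K u -> body_set L v -> enorm (u - v) <= a + b.
  move=> /aK ua /bL vb; apply: le_trans (enorm_triangle _ _) _.
  by rewrite enormN lerD.
exists (a + b); split.
- by apply: le_trans (ab _ _ Kx Ly); exact: enorm_ge0.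
- by move=> u Ku; exists y => //; exact: ab.
- by move=> v Lv; exists x => //; rewrite enormB; exact: ab.
Qed.

Lemma hausdorff_dist_le K L e : 0 <= e ->
  K `<=` parallel_set L e -> L `<=` parallel_set K e -> hausdorff_dist K L <= e.
Proof.
move=> e0 KL LK; apply: ge_inf; last by split.
by exists 0; exact: hset_lb.
Qed.

Lemma parallel_set_le (A : set 'cV[R]_n) e e' : e <= e' ->
  parallel_set A e `<=` parallel_set A e'.
Proof. by move=> ee' x [y Ay xy]; exists y => //; exact: le_trans ee'. Qed.

Lemma hausdorff_dist_lt K L e : hausdorff_dist K L < e ->
  K `<=` parallel_set L e /\ L `<=` parallel_set K e.
Proof.
move=> /(reals.inf_lt (@hset_neq0 K L))[e' [e'0 KL LK] /ltW e'e].
by split=> x; [move/KL|move/LK]; exact: parallel_set_le.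
Qed.

Let hausdorff_dist_ge0 K L : 0 <= hausdorff_dist K L.
Proof. exact: lb_le_inf (@hset_neq0 K L) (@hset_lb K L). Qed.

Let hausdorff_distxx K : hausdorff_dist K K = 0.
Proof.
apply/eqP; rewrite eq_le hausdorff_dist_ge0 andbT.
by apply: hausdorff_dist_le => // x Kx; exists x => //; rewrite subrr enorm0.
Qed.

Let hausdorff_dist_sym K L : hausdorff_dist K L = hausdorff_dist L K.
Proof. by congr inf; rewrite eqEsubset; split=> e []. Qed.

Let hausdorff_dist_sub0 K L : hausdorff_dist K L = 0 -> K `<=` L.
Proof.
move=> KL x Kx.
have /closed_enormP := compact_enorm_closed (body_compact L).
apply=> e e0; have [|/(_ x Kx)[y Ly xy] _] := @hausdorff_dist_lt K L (e / 2).
  by rewrite KL divr_gt0.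
by exists y => //; apply: le_lt_trans xy _; rewrite ltr_pdivrMr// mulr_natr mulr2n ltrDl.
Qed.

Let hausdorff_dist_positivity K L : hausdorff_dist K L = 0 -> K = L.
Proof.
move=> KL; apply: body_inj; rewrite eqEsubset.
by split; apply: hausdorff_dist_sub0 => //; rewrite hausdorff_dist_sym.
Qed.

Let hausdorff_dist_triangle M K L :
  hausdorff_dist K L <= hausdorff_dist K M + hausdorff_dist M L.
Proof.
apply/ler_addgt0Pr => e e0; set a := hausdorff_dist K M; set b := hausdorff_dist M L.
have e20 : 0 < e / 2 by rewrite divr_gt0.
have [KM MK] : K `<=` parallel_set M (a + e / 2) /\ M `<=` parallel_set K (a + e / 2).
  by apply: hausdorff_dist_lt; rewrite ltrDl.
have [ML LM] : M `<=` parallel_set L (b + e / 2) /\ L `<=` parallel_set M (b + e / 2).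
  by apply: hausdorff_dist_lt; rewrite ltrDl.
have -> : a + b + e = (a + e / 2) + (b + e / 2) by rewrite addrACA -splitr.
apply: hausdorff_dist_le.
- by rewrite !addr_ge0 ?hausdorff_dist_ge0 ?ltW.
- move=> x /KM[y My xy]; have [z Lz yz] := ML _ My; exists z => //.
  by apply: le_trans (enorm_distD _ y _) _; exact: lerD.
- move=> x /LM[y My xy]; have [z Lz yz] := MK _ My; exists z => //.
  by apply: le_trans (enorm_distD _ y _) _; rewrite addrC; exact: lerD.
Qed.

HB.instance Definition _ := isMetric.Build R (body R n)
  hausdorff_distxx hausdorff_dist_positivity hausdorff_dist_sym
  hausdorff_dist_triangle.

Lemma nbhs_bodyP K (P : set (body R n)) :
  nbhs K P <-> exists2 e : R, 0 < e & [set L | hausdorff_dist K L < e] `<=` P.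
Proof.
split=> [/nbhs_ballP[e /= e0 eP]|[e e0 eP]].
  by exists e => // L KL; apply: eP; rewrite ballEmdist.
by apply/nbhs_ballP; exists e => //= L; rewrite ballEmdist; exact: eP.
Qed.

End hausdorff_metric.

Section valuations.
Context {R : realType} {n : nat}.

(* If the union of two bodies is a body, then their intersection is one too
   ([body_setI] below), so that quantifying over a body [KIL] equal to it puts
   no restriction on K and L. *)
Definition valuation (f : body R n -> R) : Prop :=
  forall K L KUL KIL : body R n,
    KUL = K `|` L :> set _ -> KIL = K `&` L :> set _ ->
    f KUL + f KIL = f K + f L.

Definition minkowski_valuation (Phi : body R n -> body R n) : Prop :=
  forall K L KUL KIL : body R n,
    KUL = K `|` L :> set _ -> KIL = K `&` L :> set _ ->
    body_add (Phi K) (Phi L) = body_add (Phi KUL) (Phi KIL).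

Definition translation_invariant {T : Type} (f : body R n -> T) : Prop :=
  forall K x, f (body_translate K x) = f K.

Definition orthogonal_equivariant (Phi : body R n -> body R n) : Prop :=
  forall (A : 'M[R]_n) K, A *m A^T = 1%:M ->
    Phi (body_lin A K) = body_lin A (Phi K).

Definition even_map {T : Type} (f : body R n -> T) : Prop :=
  forall K, f (body_opp K) = f K.

Lemma closed_setI_is_body (K : body R n) (A : set 'cV[R]_n) :
  closed A -> convex_set (A : set (convex_lmodType 'cV[R]_n)) ->
  K `&` A !=set0 -> is_body (K `&` A).
Proof.
move=> cA vA KA0; split=> //.
  apply: (@subclosed_compact _ _ K) => //; last exact: body_compact.
  by apply: closedI => //; apply: compact_enorm_closed; exact: body_compact.
move/convex_setP : vA => vA; apply/convex_setP => x y t t0 t1 [Kx Ax] [Ky Ay].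
by split; [exact: body_convex|exact: vA].
Qed.

Lemma body_setI (K L KUL : body R n) :
  KUL = K `|` L :> set _ -> exists KIL : body R n, KIL = K `&` L :> set _.
Proof.
move=> KULE; suff KIL0 : K `&` L !=set0.
  have cL : closed L by apply: compact_enorm_closed; exact: body_compact.
  have vL : convex_set (L : set (convex_lmodType 'cV[R]_n)).
    by have [] := bodyP L.
  by exists (Body (closed_setI_is_body cL vL KIL0)).
have [x0 Kx0] := body_nonempty K; have [y0 Ly0] := body_nonempty L.
have KL0 : (K `*` L) !=set0 by exists (x0, y0).
have cKL : compact (K `*` L) by apply: compact_setX; exact: body_compact.
have [|[x y] /set_mem[/= Kx Ly] xymin] := @compact_EVT_min _ R
    (fun p : 'cV[R]_n * 'cV[R]_n => enorm (p.1 - p.2)) _ KL0 cKL.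
  have sc : continuous (fun p : 'cV[R]_n * 'cV[R]_n => p.1 - p.2).
    exact: sub_continuous.
  apply: continuous_subspaceT => p.
  exact: (continuous_comp (sc p) (@enorm_continuous R n (p.1 - p.2))).
have {}xymin u v : body_set K u -> body_set L v -> enorm (x - y) <= enorm (u - v).
  by move=> Ku Lv; apply: (xymin (u, v)); exact/mem_set.
pose z := 2^-1 *: x + (1 - 2^-1) *: y.
have hE : 1 - 2^-1 = 2^-1 :> R by lra.
have zy : z - y = 2^-1 *: (x - y).
  by apply/matrixP => i j; rewrite /z !mxE; lra.
have xz : x - z = 2^-1 *: (x - y).
  apply/matrixP => i j; rewrite /z !mxE; lra.
have : body_set KUL z.
  apply: body_convex; rewrite ?invr_ge0 ?invf_le1 ?ler1n//.
    by rewrite KULE; left.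
  by rewrite KULE; right.
have xy0 : enorm (x - y) <= 2^-1 * enorm (x - y) -> K `&` L !=set0.
  move=> h; exists x; split => //; suff -> : x = y by [].
  apply/eqP; rewrite -subr_eq0; apply/eqP/enorm_eq0.
  by have := enorm_ge0 (x - y); lra.
rewrite KULE => -[Kz|Lz]; apply: xy0.
  by have := xymin _ _ Kz Ly; rewrite zy enormZ ger0_norm.
by have := xymin _ _ Kx Lz; rewrite xz enormZ ger0_norm.
Qed.

Section cutting.
Variables (i : 'I_n) (c : R).

Lemma closed_halfspace_le : closed [set x : 'cV[R]_n | x i 0 <= c].
Proof.
apply/closed_enormP => x h /=; rewrite leNgt; apply/negP => cx.
have /h[y /= yc] : 0 < x i 0 - c by rewrite subr_gt0.
move/(le_lt_trans (coord_le_enorm _ i)); rewrite !mxE => /ltr_normlW.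
by lra.
Qed.

Lemma closed_halfspace_ge : closed [set x : 'cV[R]_n | c <= x i 0].
Proof.
apply/closed_enormP => x h /=; rewrite leNgt; apply/negP => cx.
have /h[y /= yc] : 0 < c - x i 0 by rewrite subr_gt0.
move/(le_lt_trans (coord_le_enorm _ i)); rewrite !mxE distrC => /ltr_normlW.
by lra.
Qed.

Lemma halfspace_le_is_body (K : body R n) :
  K `&` [set x | x i 0 <= c] !=set0 -> is_body (K `&` [set x | x i 0 <= c]).
Proof.
apply: closed_setI_is_body; first exact: closed_halfspace_le.
by apply/convex_setP => x y t t0 t1 /=; rewrite !mxE => xc yc; nra.
Qed.

Lemma halfspace_ge_is_body (K : body R n) :
  K `&` [set x | c <= x i 0] !=set0 -> is_body (K `&` [set x | c <= x i 0]).
Proof.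
apply: closed_setI_is_body; first exact: closed_halfspace_ge.
by apply/convex_setP => x y t t0 t1 /=; rewrite !mxE => xc yc; nra.
Qed.

End cutting.

(* Cut a body by hyperplanes into pieces that fit into a translate of the unit
   ball. *)
Lemma valuation_eq0 (f : body R n -> R) :
  translation_invariant f -> valuation f ->
  (forall K : body R n, K `<=` unit_ball -> f K = 0) -> forall K, f K = 0.
Proof.
move=> tf vf f0.
pose d : R := n.+1%:R^-1.
have d0 : 0 < d by rewrite invr_gt0.
pose narrow (K : body R n) (i : 'I_n) :=
  exists a : R, forall x, body_set K x -> a <= x i 0 <= a + d.
have box0 K : (forall i, narrow K i) -> f K = 0.
  move=> /choice[a aK]; pose v : 'cV[R]_n := \col_i a i.
  rewrite -(tf K (- v)); apply: f0 => _ [x Kx <-] /=; rewrite /unit_ball /=.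
  apply: le_trans (enorm_mx_norm _) _; apply: (@le_trans _ _ (n%:R * d)).
    rewrite ler_wpM2l//; apply: mx_norm_le => [|i j]; first exact: ltW.
    rewrite !mxE (ord1 j); have /andP[ax xa] := aK i x Kx.
    by rewrite ger0_norm ?subr_ge0// lerBlDl.
  by rewrite /d ler_pdivrMr// mul1r ler_nat.
have step s : forall K, (forall i : 'I_n, (s <= i)%N -> narrow K i) -> f K = 0.
  elim: s => [K nK|s IHs K nK]; first by apply: box0 => i; exact: nK.
  have [sn|ns] := ltnP s n; last first.
    by apply: IHs => i si; have := leq_trans (ltn_ord i) ns; rewrite ltnNge si.
  pose j := Ordinal sn.
  have slab m : forall (L : body R n) a,
      (forall i : 'I_n, (s < i)%N -> narrow L i) ->
      (forall x, body_set L x -> a <= x j 0 <= a + m%:R * d) -> f L = 0.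
    elim: m => [|m IHm] L a nL aL.
      apply: IHs => i; rewrite leq_eqVlt => /predU1P[si|]; last exact: nL.
      have -> : i = j by exact/val_inj.
      exists a => x /aL /andP[-> xa] /=.
      by apply: le_trans xa _; rewrite mul0r addr0 lerDl ltW.
    pose c := a + d.
    have [Lm0|/set0P Lm0] := eqVneq (L `&` [set x | x j 0 <= c]) set0.
      apply: (IHm L c) => // x Lx; have /andP[_ xa] := aL x Lx.
      apply/andP; split; last by move: xa; rewrite /c -natr1 mulrDl mul1r; lra.
      rewrite leNgt; apply/negP => /ltW xc.
      by have : set0 x by rewrite -Lm0.
    have [Lp0|/set0P Lp0] := eqVneq (L `&` [set x | c <= x j 0]) set0.
      apply: IHs => i; rewrite leq_eqVlt => /predU1P[si|]; last exact: nL.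
      have -> : i = j by exact/val_inj.
      exists a => x Lx; have /andP[-> _] /= := aL x Lx.
      rewrite leNgt; apply/negP => /ltW xc.
      by have : set0 x by rewrite -Lp0.
    pose Lm := Body (halfspace_le_is_body Lm0).
    pose Lp := Body (halfspace_ge_is_body Lp0).
    have L00 : Lm `&` [set x | c <= x j 0] !=set0.
      have [x [Lx /= xc]] := Lm0; have [y [Ly /= yc]] := Lp0.
      have [xy|xy] := eqVneq (x j 0) (y j 0).
        by exists x; split=> //=; rewrite xy.
      have yx : 0 < y j 0 - x j 0.
        by rewrite subr_gt0 lt_neqAle xy (le_trans xc yc).
      pose t := (y j 0 - c) / (y j 0 - x j 0).
      have tE : t * x j 0 + (1 - t) * y j 0 = c.
        have yxt : t * (y j 0 - x j 0) = y j 0 - c by rewrite /t mulfVK// gt_eqF.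
        by lra.
      have t0 : 0 <= t by rewrite divr_ge0 ?subr_ge0// (le_trans xc yc).
      have t1 : t <= 1 by rewrite /t ler_pdivrMr// mul1r lerD2l lerN2.
      exists (t *: x + (1 - t) *: y).
      by split; [split; first exact: body_convex|] => /=; rewrite !mxE tE.
    pose L0 := Body (halfspace_ge_is_body L00).
    have sub (L' : body R n) : L' `<=` L ->
        forall i : 'I_n, (s < i)%N -> narrow L' i.
      by move=> L'L i /nL[b bL]; exists b => x /L'L; exact: bL.
    have fLm : f Lm = 0.
      apply: IHs => i; rewrite leq_eqVlt => /predU1P[si|].
        have -> : i = j by exact/val_inj.
        by exists a => x [Lx /= ->]; have /andP[-> _] := aL x Lx.
      by apply: sub => x [].
    have fL0 : f L0 = 0.
      apply: IHs => i; rewrite leq_eqVlt => /predU1P[si|].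
        have -> : i = j by exact/val_inj.
        by exists a => x [[Lx /= ->] _]; have /andP[-> _] := aL x Lx.
      by apply: sub => x [[]].
    have fLp : f Lp = 0.
      apply: (IHm _ c); first by apply: sub => x [].
      move=> x [Lx /= ->]; have /andP[_ xa] := aL x Lx.
      by move: xa; rewrite /c -natr1 mulrDl mul1r => xa; lra.
    have : f L + f L0 = f Lm + f Lp.
      apply: vf => /=; rewrite eqEsubset; split=> x.
      - by move=> Lx; have [xc|/ltW xc] := leP (x j 0) c; [left|right].
      - by case=> -[].
      - by move=> [[Lx xc] cx].
      - by move=> [[Lx xc] [_ cx]].
    by rewrite fL0 fLm fLp !addr0.
  have [M MK] := compact_enorm_bounded (body_compact K).
  have [m mM] : exists m : nat, 2 * M <= m%:R * d.
    exists (Num.bound `|2 * M / d|); rewrite -ler_pdivrMr//.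
    apply: le_trans (ler_norm _) _.
    by rewrite ltW// archi_boundP.
  apply: (slab m K (- M)) => // x Kx.
  have := le_trans (coord_le_enorm x j) (MK x Kx); rewrite ler_norml => /andP[-> xM] /=.
  by lra.
by move=> K; apply: (step n) => i ni; have := ltn_ord i; rewrite ltnNge ni.
Qed.

End valuations.

Section selection.
Context {R : realType} {n : nat}.
Implicit Types (K L : body R n) (x y : 'cV[R]_n).

Let ball_compact : compact (@unit_ball R n).
Proof.
apply: (@closed_enorm_compact _ _ _ 1) => //.
apply/closed_enormP => x h; rewrite /unit_ball /=.
apply/ler_addgt0Pr => e e0; have [y y1 xy] := h _ e0.
rewrite -[x](subrK y); apply: le_trans (enorm_triangle _ _) _.
by rewrite addrC lerD// ltW.
Qed.

Let ultra_ball_lim (F : set_system (body R n)) (g : body R n -> 'cV[R]_n) :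
  UltraFilter F -> F [set K : body R n | unit_ball (g K)] ->
  exists x, forall e : R, 0 < e -> F [set K : body R n | enorm (x - g K) < e].
Proof.
move=> UF Fg; have PF : ProperFilter F by exact: ultra_proper.
have [x [_ clx]] := ball_compact (fmap_proper_filter g PF) Fg.
exists x => e e0.
have [//|Fn] := in_ultra_setVsetC [set K | enorm (x - g K) < e] UF.
have [y []//] : ((~` [set y | enorm (x - y) < e]) `&`
    [set y | enorm (x - y) < e]) !=set0.
  by apply: clx => //; apply/nbhs_enormP; exists e.
Qed.

(* Blaschke's selection theorem *)
Lemma bodies_in_ball_compact : compact [set K : body R n | K `<=` unit_ball].
Proof.
rewrite compact_ultra => F UF FB; have PF : ProperFilter F by exact: ultra_proper.
pose L : set 'cV[R]_n :=
  [set x | forall e : R, 0 < e -> F [set K : body R n | parallel_set K e x]].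
have lim_in (g : body R n -> 'cV[R]_n) : F [set K : body R n | K `<=` unit_ball /\ body_set K (g K)] ->
    exists2 x, L x & forall e : R, 0 < e -> F [set K : body R n | enorm (x - g K) < e].
  move=> Fg; have [|x xg] := @ultra_ball_lim F g UF.
    by apply: filterS Fg => K [KB /KB].
  exists x => // e e0; apply: filterS (filterI Fg (xg _ e0)).
  by move=> K [[_ Kg] /ltW xK]; exists (g K).
have LB : L `<=` unit_ball.
  move=> x Lx; rewrite /unit_ball /=; apply/ler_addgt0Pr => e e0.
  have [K [[y Ky xy] KB]] := filter_ex (filterI (Lx _ e0) FB).
  rewrite -[x](subrK y); apply: le_trans (enorm_triangle _ _) _.
  by rewrite addrC lerD//; exact: KB.
have cL : closed L.
  apply/closed_enormP => x h e e0.
  have [|y Ly xy] := h (e / 2); first by rewrite divr_gt0.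
  have := Ly (e / 2); rewrite divr_gt0// => /(_ isT).
  apply: filterS => K [z Kz yz]; exists z => //.
  by apply: le_trans (enorm_distD _ y _) _; rewrite (splitr e) lerD// ltW.
have L0 : L !=set0.
  have [g gK] := choice (@body_nonempty R n).
  by have [|x Lx _] := lim_in g; [apply: filterS FB|exists x].
have bL : is_body L.
  split=> //; first exact: closed_enorm_compact cL LB.
  apply/convex_setP => x y t t0 t1 Lx Ly e e0.
  apply: filterS (filterI (Lx _ e0) (Ly _ e0)) => K [[u Ku xu] [v Kv yv]].
  exists (t *: u + (1 - t) *: v); first exact: body_convex.
  have -> : t *: x + (1 - t) *: y - (t *: u + (1 - t) *: v) =
      t *: (x - u) + (1 - t) *: (y - v).
    by rewrite !scalerBr opprD addrACA.
  apply: le_trans (enorm_triangle _ _) _; rewrite !enormZ.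
  by rewrite !ger0_norm ?subr_ge0//; nra.
exists (Body bL); split=> //.
move=> P /nbhs_bodyP[e e0 eP]; apply: filterS eP _.
have e20 : 0 < e / 2 by rewrite divr_gt0.
have KL : F [set K : body R n | K `<=` parallel_set L (e / 2)].
  have [//|Fn] := in_ultra_setVsetC [set K : body R n | K `<=` parallel_set L (e / 2)] UF.
  pose g (K : body R n) := xget 0 [set x | body_set K x /\ ~ parallel_set L (e / 2) x].
  have gP (K : body R n) : ~ (K `<=` parallel_set L (e / 2)) ->
      body_set K (g K) /\ ~ parallel_set L (e / 2) (g K).
    move=> nKL; apply: (@xgetPex _ 0 [set x | body_set K x /\ ~ parallel_set L (e / 2) x]).
    apply: contrapT => h; apply: nKL => x Kx; apply: contrapT => nLx.
    by apply: h; exists x.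
  have [|x Lx xg] := lim_in g.
    by apply: filterS (filterI FB Fn) => K [KB /gP[]].
  have [K [/gP[_ nLg] /ltW xK]] := filter_ex (filterI Fn (xg _ e20)).
  by exfalso; apply: nLg; exists x => //; rewrite enormB.
have LK : F [set K : body R n | L `<=` parallel_set K (e / 2)].
  have [//|Fn] := in_ultra_setVsetC [set K : body R n | L `<=` parallel_set K (e / 2)] UF.
  pose g (K : body R n) := xget 0 [set x | L x /\ ~ parallel_set K (e / 2) x].
  have gP (K : body R n) : ~ (L `<=` parallel_set K (e / 2)) ->
      L (g K) /\ ~ parallel_set K (e / 2) (g K).
    move=> nKL; apply: (@xgetPex _ 0 [set x | L x /\ ~ parallel_set K (e / 2) x]).
    apply: contrapT => h; apply: nKL => x Kx; apply: contrapT => nLx.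
    by apply: h; exists x.
  have [|x xg] := @ultra_ball_lim F g UF.
    by apply: filterS Fn => K /gP[/LB].
  have e40 : 0 < e / 2 / 2 by rewrite divr_gt0.
  have Lx : L x.
    move/closed_enormP : cL; apply=> d d0.
    have [K [/gP[Lg _] xK]] := filter_ex (filterI Fn (xg _ d0)).
    by exists (g K).
  have [K [[/gP[_ nKg] xK] [y Ky xy]]] :=
    filter_ex (filterI (filterI Fn (xg _ e40)) (Lx _ e40)).
  exfalso; apply: nKg; exists y => //.
  apply: le_trans (enorm_distD _ x _) _; rewrite (splitr (e / 2)) lerD//.
  by rewrite enormB ltW.
apply: filterS (filterI KL LK) => K [KL' LK'] /=.
apply: (@le_lt_trans _ _ (e / 2)); last by rewrite ltr_pdivrMr// mulr_natr mulr2n ltrDl.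
by apply: hausdorff_dist_le => //; exact: ltW.
Qed.

End selection.

Section Val.
Variables (R : realType) (n : nat).

Definition val_pred : {pred body R n -> R} :=
  [pred f | `[< [/\ continuous f, translation_invariant f & valuation f] >]].

Record Val := MkVal {
  val_fun :> body R n -> R;
  _ : val_fun \in val_pred }.

HB.instance Definition _ := [isSub for val_fun].
HB.instance Definition _ := [Choice of Val by <:].

Lemma val_predP (f : body R n -> R) : f \in val_pred <->
  [/\ continuous f, translation_invariant f & valuation f].
Proof. by split=> [/asboolP//|h]; exact/asboolP. Qed.

Lemma ValP (f : Val) :
  [/\ continuous f, translation_invariant f & valuation f].
Proof. by apply/val_predP; exact: (valP f). Qed.

Let val_submod_closed : submod_closed val_pred.
Proof.
split=> [|a f g /val_predP[cf tf vf] /val_predP[cg tg vg]]; apply/val_predP.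
  split=> [|//|K L M N _ _]; first exact: (@cst_continuous (body R n) R 0).
  by rewrite /= addr0.
have E K : (a *: f + g) K = a * f K + g K by [].
split=> [K|K x|K L KUL KIL KULE KILE].
- apply: (continuousD (f := fun K => a * f K) (g := g)); last exact: cg.
  apply: (continuousM (s := fun=> a) (t := f)); last exact: cf.
  exact: cst_continuous.
- by rewrite !E tf tg.
- rewrite !E addrACA -mulrDr (vf _ _ _ _ KULE KILE) (vg _ _ _ _ KULE KILE).
  by rewrite mulrDr addrACA.
Qed.

HB.instance Definition _ := GRing.isSubmodClosed.Build R (body R n -> R)
  val_pred val_submod_closed.
HB.instance Definition _ := [SubChoice_isSubLmodule of Val by <:].

Definition val_norm (f : Val) : R :=
  sup [set `|f K| | K in [set K : body R n | K `<=` unit_ball]].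

Lemma val_funD (f g : Val) K : (f + g) K = f K + g K.
Proof. by []. Qed.

Lemma val_funZ (a : R) (f : Val) K : (a *: f) K = a * f K.
Proof. by []. Qed.

Lemma val_fun_inj (f g : Val) : (forall K, f K = g K) -> f = g.
Proof. by move=> fg; apply/val_inj/funext. Qed.

Let singleton_is_body : is_body [set (0 : 'cV[R]_n)].
Proof.
split; [by exists 0|exact: compact_set1|].
by apply/convex_setP => x y t _ _ /= -> ->; rewrite !scaler0 addr0.
Qed.

Let val_norm_set_neq0 (f : Val) :
  [set `|f K| | K in [set K : body R n | K `<=` unit_ball]] !=set0.
Proof.
exists `|f (Body singleton_is_body)|; exists (Body singleton_is_body) => //.
by move=> x /= ->; rewrite /unit_ball /= enorm0.
Qed.

Lemma val_norm_bound (f : Val) (K : body R n) :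
  K `<=` unit_ball -> `|f K| <= val_norm f.
Proof.
move=> KB; apply: ub_le_sup; last by exists K.
have [cf _ _] := ValP f.
have /compact_bounded[M [_ hM]] : compact (f @` [set K : body R n | K `<=` unit_ball]).
  apply: continuous_compact; last exact: bodies_in_ball_compact.
  exact: continuous_subspaceT.
exists (M + 1) => _ [L LB <-]; apply: hM; first by rewrite ltrDl.
by exists L.
Qed.

Let val_norm_le (f : Val) (c : R) :
  (forall K : body R n, K `<=` unit_ball -> `|f K| <= c) -> val_norm f <= c.
Proof.
by move=> h; apply: ge_sup => [|_ [K KB <-]]; [exact: val_norm_set_neq0|exact: h].
Qed.

Let ler_val_normD (f g : Val) : val_norm (f + g) <= val_norm f + val_norm g.
Proof.
apply: val_norm_le => K KB; rewrite val_funD.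
by apply: le_trans (ler_normD _ _) _; rewrite lerD ?val_norm_bound.
Qed.

Let val_normZ_le (a : R) (f : Val) : val_norm (a *: f) <= `|a| * val_norm f.
Proof.
apply: val_norm_le => K KB; rewrite val_funZ normrM.
by rewrite ler_wpM2l// val_norm_bound.
Qed.

Let val_normZ (a : R) (f : Val) : val_norm (a *: f) = `|a| * val_norm f.
Proof.
apply/eqP; rewrite eq_le val_normZ_le /=.
have [->|a0] := eqVneq a 0.
  rewrite normr0 mul0r.
  have [_ [K KB _]] := val_norm_set_neq0 (0 *: f).
  by apply: le_trans (val_norm_bound (0 *: f) KB).
rewrite -ler_pdivlMl ?normr_gt0// -normfV.
by have := val_normZ_le a^-1 (a *: f); rewrite scalerA mulVf// scale1r.
Qed.

Let val_norm0_eq0 (f : Val) : val_norm f = 0 -> f = 0.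
Proof.
move=> f0; have [_ tf vf] := ValP f; apply: val_fun_inj.
apply: valuation_eq0 => // K KB; apply/eqP; rewrite -normr_le0 -f0.
exact: val_norm_bound.
Qed.

HB.instance Definition _ := Lmodule_isNormed.Build R Val
  ler_val_normD val_normZ val_norm0_eq0.

Lemma val_normE (f : Val) : `|f| = val_norm f.
Proof. by []. Qed.

End Val.

Section smoothness.
Context {R : realType}.

(* For U open and V finite-dimensional: f is C^(k+1) on U when it is Frechet
   differentiable on U and x |-> df_x(v) is C^k on U for every v; df_x being
   determined by its values on a basis, this is the usual condition on df. *)
Fixpoint is_Ck {V W : normedModType R} (U : set V) (k : nat) (f : V -> W) :
    Prop :=
  if k is k'.+1 then
    (forall x, U x -> differentiable f x) /\ forall v, is_Ck U k' ('D_v f)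
  else forall x, U x -> {for x, continuous f}.

Definition infinitely_differentiable {V W : normedModType R} (U : set V)
    (f : V -> W) : Prop :=
  forall k, is_Ck U k f.

Context {n : nat}.

Definition GL : set 'M[R]_n := [set A | A \in unitmx].

(* A |-> phi(A^-1 .), extended by 0 outside GL(n); see [gl_translateE]. *)
Definition gl_translate (phi : Val R n) (A : 'M[R]_n) : Val R n :=
  if A \in unitmx then insubd 0 (fun K => phi (body_lin (invmx A) K)) else 0.

Lemma body_lin_continuous (A : 'M[R]_n) : continuous (body_lin A).
Proof.
have [C C0 AC] := mulmx_enorm_bound A.
have sub (K L : body R n) (e : R) : K `<=` parallel_set L (e / C) ->
    body_lin A K `<=` parallel_set (body_lin A L) e.
  move=> KL _ [x /KL[y Ly xy] <-]; exists (A *m y); first by exists y.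
  rewrite -mulmxBr; apply: le_trans (AC _) _.
  by rewrite mulrC -ler_pdivlMr.
move=> K P /nbhs_bodyP[e e0 eP]; apply/nbhs_bodyP.
have e20 : 0 < e / 2 by rewrite divr_gt0.
exists (e / 2 / C) => [|L /hausdorff_dist_lt[KL LK]]; first by rewrite divr_gt0.
apply: eP; apply: (@le_lt_trans _ _ (e / 2)).
  by apply: hausdorff_dist_le; [exact: ltW|exact: sub|exact: sub].
by rewrite ltr_pdivrMr// mulr_natr mulr2n ltrDl.
Qed.

Lemma gl_translateE (phi : Val R n) (A : 'M[R]_n) K : A \in unitmx ->
  gl_translate phi A K = phi (body_lin (invmx A) K).
Proof.
move=> uA; rewrite /gl_translate uA insubdK//; apply/val_predP.
have [cphi tphi vphi] := ValP phi; split.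
- by move=> L; apply: continuous_comp; [exact: body_lin_continuous|exact: cphi].
- move=> L x; rewrite -(tphi (body_lin (invmx A) L) (invmx A *m x)); congr (phi _); apply: body_inj.
  rewrite eqEsubset; split=> [_ [_ [y Ly <-] <-]|_ [_ [y Ly <-] <-]].
    by exists (invmx A *m y); [exists y|rewrite mulmxDr].
  by exists (y + x); [exists y|rewrite mulmxDr].
- move=> L M KUL KIL KULE KILE; apply: vphi => /=.
    by rewrite KULE image_setU.
  rewrite KILE eqEsubset; split=> [_ [y [Ly My] <-]|x [[y Ly yx] [z Mz zx]]].
    by split; exists y.
  have yz : y = z.
    by rewrite -(mulKVmx uA y) yx -zx mulKVmx.
  by exists y => //; split=> //; rewrite yz.
Qed.

Definition smooth_val (phi : Val R n) : Prop :=
  infinitely_differentiable GL (gl_translate phi).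

(* For e a unit vector and Phi a continuous, translation invariant and O(n)
   equivariant Minkowski valuation: K |-> h(Phi K, e) is a smooth element of
   Val. *)
Definition smooth_minkowski_valuation (e : 'cV[R]_n)
    (Phi : body R n -> body R n) : Prop :=
  exists2 phi : Val R n,
    (forall K, phi K = support (Phi K) e) & smooth_val phi.

End smoothness.

(* Main.v *)
(* Average Phi over matrices close to the identity: let rho be a smooth bump
   near 1 on the space of matrices, invariant under conjugation by O(n), and put
   Phi_rho(K) = int rho(A) Phi(A K) dA, a Minkowski integral. Conjugation
   invariance of rho makes Phi_rho equivariant under O(n), and the other
   properties of Phi are inherited pointwise. After the substitution A -> A g, the
   GL(n)-orbit map of K |-> h(Phi_rho K, e) is, up to a scalar factor,
   g |-> int rho(A g) h(Phi(A K), e) dA, in which g occurs only in the smooth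
   kernel. The scalar factor need not be computed: by uniqueness of translation
   invariant functionals it is the quotient int h(A) dA / int h(A g) dA for any
   even bump h, which is itself smooth in g. *)

Require Import Defs.
From HB Require Import structures.
From mathcomp Require Import all_boot all_order all_algebra.
From mathcomp Require Import all_classical all_reals all_analysis.
From mathcomp Require Import ring lra zify.
Import Order.TTheory GRing.Theory Num.Theory.
Import numFieldNormedType.Exports Defs.

Set Implicit Arguments.
Unset Strict Implicit.
Unset Printing Implicit Defensive.

Local Open Scope classical_set_scope.
Local Open Scope ring_scope.

(** * Integration over the space of matrices *)

(** The obstacle is differentiability in the Banach space [Val]: difference quotients must converge
    uniformly over all bodies in the unit ball. The body [K] enters the integrals only through
    [phi (body_lin A K)], which is bounded for bounded [A] and [K] in the ball, so a first-order
    Taylor estimate for the scalar kernel, uniform in [A], suffices. Derivatives of such kernels are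
    kernels of the same class, and C^k follows by induction on k.

    The bump is a function of the squared Frobenius distance to the identity, which is both
    polynomial in the entries and invariant under conjugation. Its radius d satisfies n d < 1, which
    makes every matrix that carries weight invertible.

    The integral is a limit of Riemann sums on dyadic lattices and is used through linearity,
    monotonicity, translation invariance and Fubini. The last two give proportionality under linear
    substitutions, so no determinant is ever evaluated. Minkowski integrals exist by Blaschke
    compactness, as limits of Minkowski combinations, without a characterization of support
    functions. *)

Lemma box_index (z : int) (L : nat) : `|z| <= L%:Z ->
  0 <= z + L%:Z /\ (absz (z + L%:Z)%R < (2 * L).+1)%N.
Proof.
rewrite ler_norml => /andP[h1 h2]; split; first by lia.
suff : (absz (z + L%:Z)%R)%:Z <= (2 * L)%N%:Z by lia.
by rewrite gez0_abs; lia.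
Qed.

(** * Riemann sums on dyadic lattices *)

Section lattice_sums.
Context {R : realType} {p q : nat}.
Local Notation M := 'M[R]_(p, q).
Implicit Types (f g : M -> R) (x v : M) (a b c k : nat).

(** The radius is a natural number so that the points of mesh 2^-k in the box have integer
    coordinates of absolute value at most b 2^k. *)
Definition supported b f := forall x, b%:R < `|x| -> f x = 0.

Lemma supported_le a b f : (a <= b)%N -> supported a f -> supported b f.
Proof. by move=> ab fa x bx; apply: fa; apply: le_lt_trans bx; rewrite ler_nat. Qed.

Definition mesh k : R := 2^-1 ^+ k.

Lemma mesh_gt0 k : 0 < mesh k.
Proof. by rewrite exprn_gt0. Qed.

Lemma mesh_le1 k : mesh k <= 1.
Proof. by rewrite exprn_ile1//; lra. Qed.

Lemma mesh_cvg0 : mesh @ \oo --> 0.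
Proof. by apply: cvg_expr; rewrite ger0_norm; lra. Qed.

Lemma meshK k : mesh k * (2 ^ k)%:R = 1.
Proof. by rewrite natrX -exprMn mulVf// expr1n. Qed.

Definition lattice_point k (z : 'M[int]_(p, q)) : M :=
  mesh k *: map_mx intr z.

(** Summing over all integer matrices, rather than over a box, makes invariance under lattice
    translations a mere reindexing; [lattice_sumE] returns to a finite index type. *)
Definition lattice_sum k f : R :=
  mesh k ^+ (p * q) * \sum_(z \in [set: 'M[int]_(p, q)]) f (lattice_point k z).

Definition box_point (L : nat) (z : 'M['I_(2 * L).+1]_(p, q)) : 'M[int]_(p, q) :=
  map_mx (fun i => (nat_of_ord i)%:Z - L%:Z) z.

Lemma box_point_inj L : injective (@box_point L).
Proof.
move=> z w zw; apply/matrixP => i j; apply/val_inj.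
have /matrixP/(_ i j) := zw; rewrite !mxE => h.
by have /eqP := addIr _ h; rewrite eqz_nat => /eqP.
Qed.

Lemma lattice_sumE b k f : supported b f ->
  lattice_sum k f = mesh k ^+ (p * q) *
    \sum_(z : 'M['I_(2 * (b * 2 ^ k)).+1]_(p, q)) f (lattice_point k (box_point z)).
Proof.
move=> bf; congr (_ * _); pose L := (b * 2 ^ k)%N.
pose r := [seq box_point z | z <- enum {: 'M['I_(2 * L).+1]_(p, q)}].
rewrite (fsbigE r) => [|||z _ zr].
- rewrite big_map big_enum_cond /=; apply: eq_bigl => z.
  by rewrite in_setT.
- by rewrite map_inj_uniq ?enum_uniq//; exact: box_point_inj.
- by [].
- apply: bf; rewrite ltNge; apply/negP => zb; move/negP: zr; apply.
  have zL i j : `|z i j| <= L%:Z.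
    have := le_trans (mx_coord_le (lattice_point k z) i j) zb.
    rewrite !mxE normrM gtr0_norm ?mesh_gt0// -(ler_pM2l (mesh_gt0 k)).
    rewrite -intr_norm => h.
    have : `|z i j|%:~R <= (L%:Z)%:~R :> R; last by rewrite ler_int.
    rewrite -(ler_pM2l (mesh_gt0 k)) -(ler_pM2l (mesh_gt0 k)).
    move: h => /le_trans; apply; rewrite ler_pM2l ?mesh_gt0// -pmulrn /L natrM mulrCA.
    by rewrite meshK mulr1.
  have zi i j := proj2 (box_index (zL i j)).
  apply/mapP; exists (\matrix_(i, j) Ordinal (zi i j)); first by rewrite mem_enum.
  apply/matrixP => i j; rewrite !mxE /= gez0_abs ?addrK//.
  exact: proj1 (box_index (zL i j)).
Qed.

Lemma lattice_sumD b k f g : supported b f -> supported b g ->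
  lattice_sum k (fun x => f x + g x) = lattice_sum k f + lattice_sum k g.
Proof.
move=> bf bg; rewrite !(@lattice_sumE b)//; last by move=> x bx; rewrite bf ?bg ?addr0.
by rewrite big_split mulrDr.
Qed.

Lemma lattice_sumZ b k (s : R) f : supported b f ->
  lattice_sum k (fun x => s * f x) = s * lattice_sum k f.
Proof.
move=> bf; rewrite !(@lattice_sumE b)//; last by move=> x bx; rewrite bf ?mulr0.
by rewrite -mulr_sumr mulrCA.
Qed.

(** The box contains (2 b 2^k + 1)^(pq) lattice points, and (2 b 2^k + 1) 2^-k = 2 b + 2^-k is at
    most 2 b + 1 for every k. *)
Lemma lattice_sum_bound b k f (s : R) : supported b f ->
  (forall x, `|f x| <= s) -> `|lattice_sum k f| <= (2 * b%:R + 1) ^+ (p * q) * s.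
Proof.
move=> bf fs; have s0 : 0 <= s by apply: le_trans (fs 0).
have m0 : 0 <= mesh k ^+ (p * q) by rewrite exprn_ge0// ltW// mesh_gt0.
rewrite (@lattice_sumE b)// normrM (ger0_norm m0).
apply: (@le_trans _ _ (mesh k ^+ (p * q) *
    \sum_(z : 'M['I_(2 * (b * 2 ^ k)).+1]_(p, q)) s)).
  by rewrite ler_wpM2l// (le_trans (ler_norm_sum _ _ _))// ler_sum.
rewrite sumr_const card_mx card_ord -[s *+ _]mulr_natl mulrA ler_wpM2r//.
rewrite natrX -exprMn lerXn2r ?nnegrE ?mulr_ge0 ?addr_ge0 ?mulr_ge0 ?(ltW (mesh_gt0 k))//.
rewrite -addn1 natrD !natrM mulrDr mulrCA (mulrCA (mesh k)) meshK !mulr1 lerD2l.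
exact: mesh_le1.
Qed.

Lemma lattice_sum_shift k f (w : 'M[int]_(p, q)) :
  lattice_sum k (fun x => f (x + lattice_point k w)) = lattice_sum k f.
Proof.
congr (_ * _); rewrite [RHS](reindex_fsbigT (fun z => z + w)).
  by apply: eq_fsbigr => z _; congr f; rewrite /lattice_point map_mxD scalerDr.
by exists (fun z => z - w) => z; rewrite (addrK, subrK).
Qed.

Lemma ler_lattice_sum b k f g : supported b f -> supported b g ->
  (forall x, f x <= g x) -> lattice_sum k f <= lattice_sum k g.
Proof.
move=> bf bg fg; rewrite !(@lattice_sumE b)// ler_wpM2l//.
  by rewrite exprn_ge0// ltW// mesh_gt0.
by apply: ler_sum => z _.
Qed.

(** [f] dominates [s] times the indicator of a cube of side [mesh j]. For k >= j that cube contains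
    exactly 2^(k-j) lattice points in each direction, so the bound does not depend on k and survives
    in the limit. *)
Lemma lattice_sum_lower b j k f (s : R) : (0 < b)%N -> (j <= k)%N -> supported b f ->
  (forall x, 0 <= f x) -> (forall x, `|x| <= mesh j -> s <= f x) ->
  mesh j ^+ (p * q) * s <= lattice_sum k f.
Proof.
move=> b0 jk bf f0 fs; pose L := (2 ^ (k - j))%N.
have Lk : mesh k * L%:R = mesh j.
  have -> : mesh k = mesh (k - j) * mesh j by rewrite -exprD subnK.
  by rewrite mulrAC meshK mul1r.
(* The cube is half-open to make the count of its lattice points exact. *)
pose cube x := [forall i, forall l, 0 <= x i l < mesh j].
pose f' x := if cube x then s else 0.
have cube_le x : cube x -> `|x| <= mesh j.
  move=> cx; apply: mx_norm_le => [|i l]; first exact/ltW/mesh_gt0.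
  by have /forallP/(_ i)/forallP/(_ l)/andP[x0 /ltW] := cx; rewrite ger0_norm.
have f'f x : f' x <= f x.
  by rewrite /f'; case: ifPn => [/cube_le/fs//|_]; exact: f0.
have bf' : supported b f'.
  move=> x bx; rewrite /f'; case: ifPn => // /cube_le xj.
  have : b%:R < 1 :> R by rewrite (lt_le_trans bx)// (le_trans xj)// mesh_le1.
  by rewrite (ltr_nat _ _ 1) ltnNge b0.
apply: le_trans (ler_lattice_sum k bf' bf f'f).
pose h (w : 'M['I_L]_(p, q)) : 'M[int]_(p, q) := map_mx (fun i => (nat_of_ord i)%:Z) w.
have h_inj : injective h.
  move=> z w zw; apply/matrixP => i l; apply/val_inj.
  by have /matrixP/(_ i l) := zw; rewrite !mxE => -[].
pose r := [seq h w | w <- enum {: 'M['I_L]_(p, q)}].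
rewrite /lattice_sum (fsbigE r)//; last 2 first.
- by rewrite map_inj_uniq ?enum_uniq.
- move=> z _ zr; rewrite /f'; case: ifPn => // /forallP cz; exfalso.
  move/negP: zr; apply.
  have zL i l : (absz (z i l) < L)%N /\ 0 <= z i l.
    have /forallP/(_ l) := cz i; rewrite !mxE -Lk ltr_pM2l ?mesh_gt0//.
    rewrite pmulr_rge0 ?mesh_gt0// ler0z => /andP[z0]; split=> //.
    by rewrite -ltz_nat gez0_abs// -(ltr_int R).
  apply/mapP; exists (\matrix_(i, l) Ordinal (proj1 (zL i l))); first by rewrite mem_enum.
  apply/matrixP => i l; rewrite !mxE /= gez0_abs//.
  exact: proj2 (zL i l).
rewrite big_map big_enum_cond /= (eq_bigr (fun=> s)) => [|w _].
  rewrite (eq_bigl xpredT) => [|w]; last by rewrite in_setT.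
  rewrite sumr_const card_mx card_ord -[s *+ _]mulr_natl mulrA.
  by rewrite natrX -exprMn Lk.
rewrite /f' ifT//; apply/forallP => i; apply/forallP => l; rewrite !mxE.
rewrite mulr_ge0 ?(ltW (mesh_gt0 k))//= -Lk ltr_pM2l ?mesh_gt0//.
by rewrite -pmulrn ltr_nat.
Qed.

End lattice_sums.

(** * Uniformity over compact sets and limits along an ultrafilter *)

(** Around each (x, y0) a product neighbourhood keeps [F] within e/2 of [F x y0]; applied to both
    (x', y) and (x', y0) this compares the two values, and compactness of [K] leaves finitely many
    conditions on y. *)
Lemma near_uniform_ball {R : realType} {X Y : topologicalType}
    {T : pseudoMetricType R} (F : X -> Y -> T) (K : set X) (y0 : Y) (e : R) :
  compact K -> continuous (fun z : X * Y => F z.1 z.2) -> 0 < e ->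
  \forall y \near y0, forall x, K x -> ball (F x y0) e (F x y).
Proof.
move=> cK cF e0.
have /compact_near_coveringP/(_ Y (nbhs y0) (fun y x => ball (F x y0) e (F x y))) := cK.
apply=> x Kx; have e20 : 0 < e / 2 by rewrite divr_gt0.
have /cvg_ballP/(_ _ e20) := cF (x, y0).
case=> -[A B] /= [xA yB] AB; exists (A, B) => // -[x' y] /= [Ax By].
have h1 := AB (x', y) (conj Ax By).
have h2 := AB (x', y0) (conj Ax (nbhs_singleton yB)).
exact: ball_splitr h2 h1.
Qed.

Lemma continuous_near_uniform {R : realType} {X Y : topologicalType}
    (F : X -> Y -> R) (K : set X) (y0 : Y) (e : R) :
  compact K -> continuous (fun z : X * Y => F z.1 z.2) -> 0 < e ->
  \forall y \near y0, forall x, K x -> `|F x y - F x y0| < e.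
Proof.
move=> cK cF e0; apply: filterS (near_uniform_ball y0 cK cF e0) => y h x /h.
by rewrite -ball_normE /= distrC.
Qed.

(** [mxvec] and [vec_mx] do not increase the maximum norm, so the ball is the image of a ball of row
    vectors, where Heine-Borel applies. *)
Lemma mx_ball_compact {R : realType} {p q : nat} (r : R) :
  compact [set x : 'M[R]_(p, q) | `|x| <= r].
Proof.
have nvec (x : 'M[R]_(p, q)) : `|mxvec x| <= `|x|.
  apply: mx_norm_le => // i j; rewrite (ord1 i).
  by case/mxvec_indexP: j => a b; rewrite mxvecE mx_coord_le.
have nvec' (y : 'rV[R]_(p * q)) : `|vec_mx y : 'M[R]_(p, q)| <= `|y|.
  by apply: mx_norm_le => // i j; rewrite mxE mx_coord_le.
have -> : [set x : 'M[R]_(p, q) | `|x| <= r] =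
    vec_mx @` [set y : 'rV[R]_(p * q) | `|y| <= r].
  rewrite eqEsubset; split=> [x /= xr|_ [y /= yr <-]]; last exact: le_trans yr.
  by exists (mxvec x); rewrite ?mxvecK//=; exact: le_trans xr.
apply: continuous_compact.
  apply: continuous_subspaceT => y P /nbhs_ballP[e /= e0 eP].
  apply/nbhs_ballP; exists e => // y'; rewrite -ball_normE /= => yy'.
  by apply: eP; rewrite -ball_normE /= -linearB; exact: le_lt_trans (nvec' _) yy'.
apply: bounded_closed_compact.
  by exists r; split; [exact: num_real|move=> s rs y /= yr; exact/ltW/(le_lt_trans yr)].
by apply: (@closed_comp _ _ (fun y : 'rV[R]_(p * q) => `|y|) [set s | s <= r]);
  [move=> y _; exact: norm_continuous|exact: closed_le].
Qed.

(* An ultrafilter on the naturals makes every bounded sequence, and every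
   sequence in a compact set, convergent. *)
Definition ultra_infty : set_system nat :=
  projT1 (cid (ultraFilterLemma eventually_filter)).

#[global] Instance ultra_infty_ultra : UltraFilter ultra_infty.
Proof. by rewrite /ultra_infty; case: cid => /= G []. Qed.

#[global] Instance ultra_infty_proper : ProperFilter ultra_infty.
Proof. exact: ultra_proper. Qed.

Lemma ultra_infty_eventually (P : set nat) :
  (\forall k \near \oo, P k) -> \forall k \near ultra_infty, P k.
Proof. by rewrite /ultra_infty; case: cid => /= G [_]; exact. Qed.

Lemma compact_ultra_cvg {T : topologicalType} (K : set T) (u : nat -> T) :
  compact K -> (forall k, K (u k)) -> exists2 x, K x & u @ ultra_infty --> x.
Proof.
move=> cK Ku; have [|x [Kx clx]] := cK _ (fmap_proper_filter u ultra_infty_proper).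
  by apply: (@filterE _ ultra_infty) => k; exact: Ku.
exists x => // A xA; have [//|UnA] := in_ultra_setVsetC (u @^-1` A) ultra_infty_ultra.
by have [y []//] : (~` A) `&` A !=set0 by exact: clx.
Qed.

(** * Linearity, monotonicity and positivity of the integral *)

Section integral.
Context {R : realType} {p q : nat}.
Local Notation M := 'M[R]_(p, q).
Implicit Types (f g : M -> R) (x v : M) (a b c k : nat).

(* For f continuous with compact support this is the Lebesgue integral. The
   limit along an ultrafilter exists by compactness, which saves the proof that
   the lattice sums converge. *)
Definition mxint f : R := lim ((fun k => lattice_sum k f) @ ultra_infty).

Definition box_volume b : R := (2 * b%:R + 1) ^+ (p * q).

Lemma box_volume_gt0 b : 0 < box_volume b.
Proof. by rewrite exprn_gt0// ltr_wpDl ?mulr_ge0. Qed.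

Definition test_fun b f := continuous f /\ supported b f.

Lemma test_fun_bounded b f : test_fun b f -> exists2 s, 0 < s & forall x, `|f x| <= s.
Proof.
move=> [cf sf]; have /compact_bounded[s [_ hs]] : compact (f @` [set x : M | `|x| <= b%:R]).
  by apply: continuous_compact; [exact: continuous_subspaceT|exact: mx_ball_compact].
exists (`|s| + 1) => [|x]; first by rewrite ltr_wpDl.
have [xb|/sf ->] := leP `|x| b%:R; last by rewrite normr0 ltW// ltr_wpDl.
apply: hs; last by exists x.
by rewrite (le_lt_trans (ler_norm s))// ltrDl.
Qed.

Lemma mxint_cvg b f : test_fun b f ->
  (fun k => lattice_sum k f) @ ultra_infty --> mxint f.
Proof.
move=> tf; have [s s0 fs] := test_fun_bounded tf.
have [|x _ fx] := compact_ultra_cvg (u := fun k => lattice_sum k f)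
    (@segment_compact R (- (box_volume b * s)) (box_volume b * s)).
  move=> k; have := lattice_sum_bound k (proj2 tf) fs.
  by rewrite ler_norml /= in_itv.
by rewrite /mxint (cvg_lim _ fx)//; exact: norm_hausdorff.
Qed.

Lemma mxint_unique b f l : test_fun b f ->
  (fun k => lattice_sum k f) @ ultra_infty --> l -> mxint f = l.
Proof. by move=> _ fl; apply: cvg_lim fl; exact: norm_hausdorff. Qed.

Lemma test_funD b f g : test_fun b f -> test_fun b g ->
  test_fun b (fun x => f x + g x).
Proof.
move=> [cf sf] [cg sg]; split=> [x|x bx]; last by rewrite sf ?sg ?addr0.
exact: (continuousD (cf x) (cg x)).
Qed.

Lemma test_funMl b f g : continuous f -> test_fun b g ->
  test_fun b (fun x => f x * g x).
Proof.
move=> cf [cg sg]; split=> [x|x bx]; last by rewrite sg ?mulr0.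
exact: (continuousM (cf x) (cg x)).
Qed.

Lemma test_funZ b (s : R) f : test_fun b f -> test_fun b (fun x => s * f x).
Proof. by move=> tf; apply: (test_funMl (f := fun=> s)) tf; exact: cst_continuous. Qed.

Lemma mxintD b f g : test_fun b f -> test_fun b g ->
  mxint (fun x => f x + g x) = mxint f + mxint g.
Proof.
move=> tf tg; apply: (mxint_unique (test_funD tf tg)).
under eq_cvg do rewrite (lattice_sumD _ (proj2 tf) (proj2 tg)).
exact: (cvgD (mxint_cvg tf) (mxint_cvg tg)).
Qed.

Lemma mxintZ b (s : R) f : test_fun b f -> mxint (fun x => s * f x) = s * mxint f.
Proof.
move=> tf; apply: (mxint_unique (test_funZ s tf)).
under eq_cvg do rewrite (lattice_sumZ _ _ (proj2 tf)).
exact: cvgMl_tmp (mxint_cvg tf).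
Qed.

Lemma mxintB b f g : test_fun b f -> test_fun b g ->
  mxint (fun x => f x - g x) = mxint f - mxint g.
Proof.
move=> tf tg; under eq_fun do rewrite -mulN1r.
by rewrite (mxintD tf (test_funZ _ tg)) (mxintZ _ tg) mulN1r.
Qed.

Lemma mxint0 : mxint (fun=> 0) = 0.
Proof.
have t0 : test_fun 0 (fun _ : M => 0 : R) by split=> // x; exact: cst_continuous.
by have := mxintZ 0 t0; under eq_fun do rewrite mul0r; rewrite mul0r.
Qed.

Lemma mxint_sum (I : Type) (r : seq I) b (F : I -> M -> R) :
  (forall i, test_fun b (F i)) ->
  test_fun b (fun x => \sum_(i <- r) F i x) /\
  mxint (fun x => \sum_(i <- r) F i x) = \sum_(i <- r) mxint (F i).
Proof.
move=> tF; elim: r => [|i r [tr IHr]].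
  have -> : (fun x => \sum_(i <- [::]) F i x) = fun=> 0.
    by apply/funext => x; rewrite big_nil.
  by rewrite big_nil mxint0; split=> //; split=> // x; exact: cst_continuous.
have -> : (fun x => \sum_(i <- i :: r) F i x) = (fun x => F i x + \sum_(i <- r) F i x).
  by apply/funext => x; rewrite big_cons.
rewrite big_cons -IHr (mxintD (tF i) tr); split=> //.
exact: test_funD.
Qed.

Lemma ler_mxint b f g : test_fun b f -> test_fun b g -> (forall x, f x <= g x) ->
  mxint f <= mxint g.
Proof.
move=> tf tg fg; apply: (ler_cvg_to (mxint_cvg tf) (mxint_cvg tg)).
by apply: nearW => k; exact: ler_lattice_sum (proj2 tf) (proj2 tg) fg.
Qed.

Lemma mxint_bound b f (s : R) : test_fun b f -> (forall x, `|x| <= b%:R -> `|f x| <= s) ->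
  `|mxint f| <= box_volume b * s.
Proof.
move=> tf fs; have {}fs x : `|f x| <= s.
  have [/fs//|/(proj2 tf) ->] := leP `|x| b%:R.
  by rewrite normr0; apply: le_trans (fs 0 _) => //; rewrite normr0.
apply: (cvgr_to_le (cvg_norm (mxint_cvg tf))).
by apply: nearW => k; exact: lattice_sum_bound (proj2 tf) fs.
Qed.

Lemma mxint_gt0 b f : test_fun b f -> (forall x, 0 <= f x) ->
  0 < f 0 -> 0 < mxint f.
Proof.
move=> tf f0 f00; have e0 : 0 < f 0 / 2 by rewrite divr_gt0.
have /cvgrPdist_lt/(_ _ e0)/nbhs_ballP[d /= d0 fd] := (proj1 tf) 0.
have [j jd] : exists j, mesh j < d :> R.
  have /cvgrPdist_lt/(_ _ d0)[j _ /(_ j (leqnn j))] := @mesh_cvg0 R.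
  by rewrite sub0r normrN gtr0_norm ?mesh_gt0//; exists j.
have lo : \forall k \near ultra_infty,
    mesh j ^+ (p * q) * (f 0 / 2) <= lattice_sum k f.
  apply: ultra_infty_eventually; exists j => // k /= jk.
  apply: (@lattice_sum_lower _ _ _ b.+1) => //.
  - exact: supported_le (leqnSn b) (proj2 tf).
  - move=> x xj; have := fd x; rewrite -ball_normE /= sub0r normrN.
    by move=> /(_ (le_lt_trans xj jd)); rewrite ltr_norml => /andP[]; lra.
apply: lt_le_trans (cvgr_to_ge (mxint_cvg tf) lo).
by rewrite mulr_gt0// exprn_gt0// mesh_gt0.
Qed.

Lemma supported_shift b c f v : `|v| <= c%:R -> supported b f ->
  supported (b + c) (fun x => f (x + v)).
Proof.
move=> vc sf x; rewrite natrD => bx; apply: sf.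
have := ler_normB (x + v) v; rewrite addrK => h; lra.
Qed.

Lemma test_fun_shift b c f v : `|v| <= c%:R -> test_fun b f ->
  test_fun (b + c) (fun x => f (x + v)).
Proof.
move=> vc [cf sf]; split; last exact: supported_shift.
move=> x; apply: (@continuous_comp _ _ _ (fun x => x + v) f); last exact: cf.
exact: (continuousD (f := id) (g := fun=> v)) (@cvg_id _ _) (@cst_continuous _ _ v x).
Qed.

End integral.

Lemma continuous_slice {X Y Z : topologicalType} (F : X -> Y -> Z) :
  continuous (fun z : X * Y => F z.1 z.2) ->
  (forall y, continuous (F^~ y)) /\ (forall x, continuous (F x)).
Proof.
move=> cF; split=> [y x|x y].
  apply: (@continuous_comp _ _ _ (fun x => (x, y)) (fun z => F z.1 z.2) x);
    last exact: cF.
  by apply: cvg_pair; [exact: cvg_id|exact: cvg_cst].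
apply: (@continuous_comp _ _ _ (fun y => (x, y)) (fun z => F z.1 z.2) y);
  last exact: cF.
by apply: cvg_pair; [exact: cvg_cst|exact: cvg_id].
Qed.

Lemma ex_natr_ge {R : realType} (r : R) : exists c : nat, r <= c%:R.
Proof.
exists (Num.bound `|r|); apply: le_trans (ler_norm r) _.
by apply: ltW; apply: archi_boundP.
Qed.

(** * Continuity in parameters, translation invariance and Fubini *)

Section parametric_integrals.
Context {R : realType} {p q : nat}.
Local Notation M := 'M[R]_(p, q).
Implicit Types (f g h : M -> R) (x v : M) (a b c k : nat).

Section parameter.
Context {Y : topologicalType}.
Implicit Types (F : M -> Y -> R) (y : Y).

(** Compactness gives the estimate for x in the box of radius [b]; outside it both values vanish. *)
Lemma test_fun_near_uniform b F y0 (e : R) :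
  continuous (fun z : M * Y => F z.1 z.2) ->
  (\forall y \near y0, supported b (F^~ y)) -> 0 < e ->
  \forall y \near y0, forall x, `|F x y - F x y0| <= e.
Proof.
move=> cF sF e0; have := continuous_near_uniform y0 (@mx_ball_compact R p q b%:R) cF e0.
have s0 := nbhs_singleton sF; apply: filterS2 sF => y sy h x.
have [/h/ltW//|bx] := leP `|x| b%:R.
by rewrite sy// s0// subr0 normr0 ltW.
Qed.

Lemma test_fun_near_uniformT b F y0 (e : R) :
  continuous (fun z : M * Y => F z.1 z.2) -> (forall y, supported b (F^~ y)) ->
  0 < e -> \forall y \near y0, forall x, `|F x y - F x y0| <= e.
Proof. by move=> cF sF; apply: (test_fun_near_uniform cF); exact: nearW. Qed.

Lemma mxint_continuous b F y0 :
  continuous (fun z : M * Y => F z.1 z.2) ->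
  (\forall y \near y0, supported b (F^~ y)) ->
  {for y0, continuous (fun y => mxint (F^~ y))}.
Proof.
move=> cF sF; apply/cvgrPdist_le => e e0.
have v0 := @box_volume_gt0 R p q b.
have e'0 : 0 < e / @box_volume R p q b by rewrite divr_gt0.
have s0 := nbhs_singleton sF; have [cF1 _] := continuous_slice cF.
apply: filterS2 sF (test_fun_near_uniform cF sF e'0) => y sy Fy.
rewrite -(@mxintB _ _ _ b)//.
apply: le_trans (@mxint_bound _ _ _ b _ (e / @box_volume R p q b) _ _) _.
- split=> [x|x bx]; last by rewrite s0// sy// subr0.
  by apply: continuousB; exact: cF1.
- by move=> x _; rewrite distrC; exact: Fy.
- by rewrite mulrC divfK// gt_eqF.
Qed.

Lemma mxint_continuousT b F :
  continuous (fun z : M * Y => F z.1 z.2) -> (forall y, supported b (F^~ y)) ->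
  continuous (fun y => mxint (F^~ y)).
Proof. by move=> cF sF y0; apply: (mxint_continuous cF); exact: nearW. Qed.

End parameter.

Definition lattice_floor k v : 'M[int]_(p, q) :=
  map_mx (fun r : R => Num.floor (r * (2 ^ k)%:R)) v.

Lemma lattice_floor_dist k v : `|v - lattice_point k (lattice_floor k v)| <= mesh k.
Proof.
apply: mx_norm_le => [|i j]; first exact/ltW/mesh_gt0.
rewrite !mxE; have m0 := @mesh_gt0 R k; have mK := @meshK R k.
have vE : v i j = mesh k * (v i j * (2 ^ k)%:R) by rewrite mulrCA mK mulr1.
rewrite {1}vE -mulrBr normrM (gtr0_norm m0) -[leRHS]mulr1 ler_pM2l//.
have /andP[h1 h2] := floor_itv (v i j * (2 ^ k)%:R).
by rewrite ger0_norm ?subr_ge0// lerBlDr addrC; move: h2; rewrite intrD => /ltW.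
Qed.

(** Lattice sums are exactly invariant only under lattice vectors. Rounding [v] down to a lattice
    vector moves it by at most [mesh k], and uniform continuity makes the resulting change of the
    lattice sums tend to 0. *)
Lemma mxint_shift b f v : test_fun b f -> mxint (fun x => f (x + v)) = mxint f.
Proof.
(* The extra 1 keeps the support inside radius b + c for all shifts w within distance 1 of [v], in
   particular for the rounded ones. *)
move=> tf; have [c vc] := ex_natr_ge (`|v| + 1).
have vc' : `|v| <= c%:R by lra.
have tv := test_fun_shift vc' tf.
apply: (mxint_unique tv); apply/cvgrPdist_lt => e e0.
have vol0 := @box_volume_gt0 R p q (b + c).
pose e' := e / 2 / @box_volume R p q (b + c).
have e'0 : 0 < e' by rewrite !divr_gt0.
have e20 : 0 < e / 2 by rewrite divr_gt0.
have sF : \forall w \near v, supported (b + c) (fun x => f (x + w)).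
  apply/nbhs_ballP; exists 1 => //= w; rewrite -ball_normE /= => vw.
  apply: supported_shift (proj2 tf).
  by have := ler_distD v 0 w; rewrite !sub0r !normrN; lra.
have cF : continuous (fun z : M * M => f (z.1 + z.2)).
  move=> z; have cD : continuous (fun z : M * M => z.1 + z.2) by exact: add_continuous.
  exact: (continuous_comp (cD z) (tf.1 _)).
have [d /= d0 dF] := (nbhs_ballP _ _).1 (filterI sF (test_fun_near_uniform cF sF e'0)).
have nd : \forall k \near \oo, mesh k < d :> R.
  have /cvgrPdist_lt/(_ _ d0) := @mesh_cvg0 R.
  by apply: filterS => k; rewrite sub0r normrN gtr0_norm ?mesh_gt0.
have /cvgrPdist_lt/(_ _ e20) := mxint_cvg tf.
apply: filterS2 (ultra_infty_eventually nd) => k kd fk.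
pose vk : M := lattice_point k (lattice_floor k v).
have [svk fvk] : supported (b + c) (fun x => f (x + vk)) /\
    forall x, `|f (x + vk) - f (x + v)| <= e'.
  by apply: dF; rewrite -ball_normE /=; exact: le_lt_trans (lattice_floor_dist k v) kd.
rewrite -(subrK (lattice_sum k (fun x => f (x + vk))) (mxint f)).
rewrite -addrA (splitr e); apply: le_lt_trans (ler_normD _ _) _.
rewrite ltr_leD//; first by rewrite lattice_sum_shift.
have nsv : supported (b + c) (fun x => -1 * f (x + v)).
  by move=> x bx; rewrite (proj2 tv)// mulr0.
rewrite -mulN1r -(@lattice_sumZ _ _ _ (b + c))//; last exact: proj2 tv.
rewrite -(@lattice_sumD _ _ _ (b + c))//.
apply: le_trans (@lattice_sum_bound _ _ _ (b + c) _ _ e' _ _) _.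
- by move=> x bx; rewrite svk// nsv// addr0.
- by move=> x; rewrite mulN1r.
- by rewrite mulrC divfK// gt_eqF.
Qed.

(** For a lattice sum in x the interchange is finite linearity. These sums, as functions [S k] of y,
    converge to [G] uniformly on the box, which allows passing to the limit under the integral over
    y. *)
Lemma mxint_fubini b (F : M -> M -> R) :
  continuous (fun z : M * M => F z.1 z.2) ->
  (forall x y, b%:R < `|x| \/ b%:R < `|y| -> F x y = 0) ->
  mxint (fun x => mxint (F x)) = mxint (fun y => mxint (F^~ y)).
Proof.
move=> cF sF; have [cF1 cF2] := continuous_slice cF.
have cF' : continuous (fun z : M * M => F z.2 z.1).
  move=> z; apply: (@continuous_comp _ _ _ (fun z => (z.2, z.1)) (fun z => F z.1 z.2));
    last exact: cF.
  exact: swap_continuous.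
have t1 y : test_fun b (F^~ y) by split=> [|x bx]; [exact: cF1|apply: sF; left].
have t2 x : test_fun b (F x) by split=> [|y yb]; [exact: cF2|apply: sF; right].
pose G y := mxint (F^~ y); pose H x := mxint (F x).
have tG : test_fun b G.
  split=> [|y yb]; first by apply: (mxint_continuousT cF) => y; exact: (proj2 (t1 y)).
  rewrite /G -[RHS](@mxint0 R p q); congr mxint; apply/funext => x.
  by apply: sF; right.
have tH : test_fun b H.
  split=> [|x xb]; first by apply: (mxint_continuousT cF') => x; exact: (proj2 (t2 x)).
  rewrite /H -[RHS](@mxint0 R p q); congr mxint; apply/funext => y.
  by apply: sF; left.
pose S k y := lattice_sum k (F^~ y).
have SE k : test_fun b (S k) /\ mxint (S k) = lattice_sum k H.
  have -> : S k = fun y => mesh k ^+ (p * q) *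
      \sum_(z : 'M['I_(2 * (b * 2 ^ k)).+1]_(p, q)) F (lattice_point k (box_point z)) y.
    by apply/funext => y; rewrite /S (@lattice_sumE _ _ _ b)//; exact: (proj2 (t1 y)).
  have [tS iS] := mxint_sum (index_enum {: 'M['I_(2 * (b * 2 ^ k)).+1]_(p, q)})
    (fun z => t2 (lattice_point k (box_point z))).
  split; first exact: test_funZ.
  by rewrite (mxintZ _ tS) iS (@lattice_sumE _ _ _ b)//; exact: (proj2 tH).
apply: (mxint_unique tH); apply/cvgrPdist_le => e e0.
pose vol := @box_volume R p q b.
have vol0 : 0 < vol by exact: box_volume_gt0.
pose e' := e / vol; have e'0 : 0 < e' by rewrite divr_gt0.
have e''0 : 0 < e' / 3 by rewrite divr_gt0.
(* Equicontinuity: [lattice_sum_bound] controls [S k y0 - S k y] independently of k, so convergence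
   at y0 spreads to a neighbourhood. Compactness of the box then yields uniform convergence. *)
have near_y (y0 : M) : \forall y \near y0 & k \near ultra_infty, `|G y - S k y| <= e'.
  have /cvgrPdist_le/(_ _ e''0) nG := tG.1 y0.
  have /cvgrPdist_le/(_ _ e''0) nS := mxint_cvg (t1 y0).
  have e3 : 0 < e' / 3 / vol by rewrite divr_gt0.
  have nF := test_fun_near_uniformT y0 cF (fun y => proj2 (t1 y)) e3.
  exists ([set y | `|G y0 - G y| <= e' / 3] `&` [set y | forall x, `|F x y - F x y0| <= e' / 3 / vol],
    [set k | `|G y0 - S k y0| <= e' / 3]).
    by split; [exact: filterI nG nF|exact: nS].
  move=> -[y k] /= [[Gy Fy] Sy].
  have SS : `|S k y0 - S k y| <= e' / 3.
    rewrite /S -[- _]mulN1r -(@lattice_sumZ _ _ _ b); last exact: (proj2 (t1 y)).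
    rewrite -(@lattice_sumD _ _ _ b); [|exact: (proj2 (t1 _))|exact: (proj2 (test_funZ _ (t1 _)))].
    apply: le_trans (@lattice_sum_bound _ _ _ b _ _ (e' / 3 / vol) _ _) _.
    - by move=> x bx; rewrite !(sF x) ?mulr0 ?addr0//; left.
    - by move=> x; rewrite mulN1r distrC.
    - by rewrite -[_ ^+ _]/vol mulrC divfK// gt_eqF.
  have -> : G y - S k y = (G y - G y0) + (G y0 - S k y0) + (S k y0 - S k y).
    by rewrite subrKA subrKA.
  have := ler_normD (G y - G y0 + (G y0 - S k y0)) (S k y0 - S k y).
  have := ler_normD (G y - G y0) (G y0 - S k y0).
  rewrite (distrC (G y)); lra.
have /compact_near_coveringP/(_ _ ultra_infty (fun k y => `|G y - S k y| <= e')) :=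
  @mx_ball_compact R p q b%:R.
move=> /(_ _ (fun y _ => near_y y)); apply: filterS => k hk.
have [tS <-] := SE k; rewrite -(mxintB tG tS).
apply: le_trans (@mxint_bound _ _ _ b _ e' _ hk) _.
  by split=> [y|y yb]; [apply: continuousB; [exact: tG.1|exact: tS.1]|rewrite tG.2// tS.2// subr0].
by rewrite -/vol mulrC divfK// gt_eqF.
Qed.

End parametric_integrals.

(** * Linear changes of variables *)

Section change_of_variables.
Context {R : realType} {p q : nat}.
Local Notation M := 'M[R]_(p, q).
Variables (T T' : M -> M).
Hypotheses (T_continuous : continuous T) (T'_continuous : continuous T')
  (TK : cancel T T') (T'K : cancel T' T) (TD : {morph T : x y / x + y}).

Lemma bounded_preimage b : exists c : nat, forall x, `|T x| <= b%:R -> `|x| <= c%:R.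
Proof.
have /compact_bounded[s [_ hs]] : compact (T' @` [set x : M | `|x| <= b%:R]).
  by apply: continuous_compact; [exact: continuous_subspaceT|exact: mx_ball_compact].
have [c sc] := ex_natr_ge (s + 1); exists c => x Tx; apply: le_trans sc.
by apply: hs; [rewrite ltrDl|exists (T x)].
Qed.

Lemma test_fun_comp b f : test_fun b f -> exists c, test_fun c (f \o T).
Proof.
move=> [cf sf]; have [c Tc] := bounded_preimage b; exists c; split=> [x|x cx].
  by apply: continuous_comp; [exact: T_continuous|exact: cf].
by apply: sf; rewrite ltNge; apply/negP => /Tc; rewrite leNgt cx.
Qed.

(* The functional [f |-> mxint (f \o T)] is again translation invariant, hence
   proportional to [mxint]: compute the double integrals of [f x * h (T y - x)]
   and [f (x + T y) * h x] in both orders. *)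
Lemma mxint_linear_change b f h : test_fun b f -> test_fun b h ->
  (forall x, h (- x) = h x) ->
  mxint (f \o T) * mxint h = mxint (h \o T) * mxint f.
Proof.
move=> tf th hN; have [c1 tfT] := test_fun_comp tf; have [c2 thT] := test_fun_comp th.
(* If one of the products is nonzero, then |x| and either |T y - x| or |x + T y| are at most b,
   hence |T y| is at most 2 b. *)
have [c Tc] := bounded_preimage (b + b).
pose F1 x y := f x * h (T y - x); pose F2 x y := f (x + T y) * h x.
have cT : continuous (fun z : M * M => T z.2).
  by move=> z; apply: continuous_comp; [exact: cvg_snd|exact: T_continuous].
have cF1 : continuous (fun z : M * M => F1 z.1 z.2).
  move=> z; apply: continuousM.
    by apply: continuous_comp; [exact: cvg_fst|exact: tf.1].
  apply: (@continuous_comp _ _ _ (fun z : M * M => T z.2 - z.1)); last exact: th.1.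
  by apply: continuousB; [exact: cT|exact: cvg_fst].
have cF2 : continuous (fun z : M * M => F2 z.1 z.2).
  move=> z; apply: continuousM; last first.
    by apply: continuous_comp; [exact: cvg_fst|exact: th.1].
  apply: (@continuous_comp _ _ _ (fun z : M * M => z.1 + T z.2)); last exact: tf.1.
  by apply: continuousD; [exact: cvg_fst|exact: cT].
pose B := (b + c)%N.
have bB x : B%:R < `|x| -> b%:R < `|x|.
  by apply: le_lt_trans; rewrite ler_nat leq_addr.
have cB y : B%:R < `|y| -> (b + b)%:R < `|T y|.
  move=> By; rewrite ltNge; apply/negP => /Tc; rewrite leNgt => /negP; apply.
  by apply: le_lt_trans By; rewrite ler_nat leq_addl.
have sF1 x y : B%:R < `|x| \/ B%:R < `|y| -> F1 x y = 0.
  rewrite /F1 => -[/bB/(proj2 tf) ->|/cB yb]; first by rewrite mul0r.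
  have [xb|/(proj2 tf) ->] := leP `|x| b%:R; last by rewrite mul0r.
  rewrite (proj2 th) ?mulr0//; move: yb; rewrite natrD => yb.
  by have := ler_normD (T y - x) x; rewrite subrK => h1; lra.
have sF2 x y : B%:R < `|x| \/ B%:R < `|y| -> F2 x y = 0.
  rewrite /F2 => -[/bB/(proj2 th) ->|/cB yb]; first by rewrite mulr0.
  have [xb|/(proj2 th) ->] := leP `|x| b%:R; last by rewrite mulr0.
  rewrite (proj2 tf) ?mul0r//; move: yb; rewrite natrD => yb.
  have := ler_normB (x + T y) x; rewrite addrC addKr => h1.
  by move: (h1); rewrite addrC; lra.
(* For fixed x the function y |-> f (x + T y) is [f \o T] shifted by [T' x], so the inner integral
   does not see x. *)
transitivity (mxint (fun x => mxint (F2 x))).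
  rewrite mulrC [LHS]mulrC -(mxintZ _ th); congr mxint; apply/funext => x.
  rewrite -(@mxint_shift _ _ _ _ _ (T' x) tfT) mulrC.
  have tfT' : exists c, test_fun c (fun y => (f \o T) (y + T' x)).
    have [a xa] := ex_natr_ge `|T' x|.
    by exists (c1 + a)%N; exact: test_fun_shift.
  have [c' tc'] := tfT'.
  rewrite -(mxintZ _ tc'); congr mxint; apply/funext => y.
  by rewrite /F2 /= TD T'K addrC mulrC.
rewrite (mxint_fubini cF2 sF2).
transitivity (mxint (fun x => mxint (F1 x))); last first.
  rewrite -(mxintZ _ tf); congr mxint; apply/funext => x.
  rewrite -(@mxint_shift _ _ _ _ _ (- T' x) thT) mulrC.
  have [a xa] := ex_natr_ge `|- T' x|.
  rewrite -(mxintZ _ (test_fun_shift xa thT)); congr mxint; apply/funext => y.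
  have TN : T (- T' x) = - x.
    apply/eqP; rewrite -subr_eq0 opprK -{2}(T'K x) -TD addNr.
    by rewrite -(addrK (T 0) (T 0)) -TD addr0 subrr.
  by rewrite /F1 /= TD TN.
rewrite (mxint_fubini cF1 sF1); congr mxint; apply/funext => y.
have tF1 : test_fun B (F1^~ y).
  by split=> [|x xB]; [exact: (continuous_slice cF1).1|apply: sF1; left].
(* For fixed y the shift x |-> x + T y turns [F1] into f (x + T y) * h (- x); evenness of [h] makes
   this [F2]. *)
rewrite -(mxint_shift (T y) tF1); congr mxint; apply/funext => x.
by rewrite /F1 /F2 opprD addrCA subrr addr0 hN.
Qed.

End change_of_variables.

(** * Support functions and Minkowski integrals *)

Lemma continuous_distP {R : realType} {T : topologicalType} {V : normedModType R}
    (f : T -> V) :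
  continuous f <-> forall x (e : R), 0 < e -> nbhs x [set y | `|f x - f y| <= e].
Proof.
split=> [cf x e e0|h x]; first by have /cvgrPdist_le/(_ _ e0) := cf x.
by apply/cvgrPdist_le => e e0; exact: h.
Qed.

Section support_functions.
Context {R : realType} {n : nat}.
Implicit Types (K L : body R n) (u x y : 'cV[R]_n) (A : 'M[R]_n) (r s e : R).

Lemma support_ge K u x : body_set K x -> dot u x <= support K u.
Proof. by move=> Kx; have [y _ [<-]] := support_max K u; exact. Qed.

Lemma support_eq K u s : (forall x, body_set K x -> dot u x <= s) ->
  (exists2 x, body_set K x & dot u x = s) -> support K u = s.
Proof.
move=> Ks [x Kx xs]; apply/eqP; rewrite eq_le -{2}xs support_ge// andbT.
by have [y Ky [<- _]] := support_max K u; exact: Ks.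
Qed.

Lemma support_add K L u : support (body_add K L) u = support K u + support L u.
Proof.
have [x Kx [xK _]] := support_max K u; have [y Ly [yL _]] := support_max L u.
apply: support_eq => [_ [x' Kx' [y' Ly' <-]]|].
  by rewrite dotDr lerD// support_ge.
by exists (x + y); [exists x => //; exists y|rewrite dotDr xK yL].
Qed.

Lemma dot_mulmx A u x : dot u (A *m x) = dot (A^T *m u) x.
Proof.
have -> : dot u (A *m x) = (u^T *m (A *m x)) 0 0.
  by rewrite !mxE; apply: eq_bigr => i _; rewrite !mxE.
have -> : dot (A^T *m u) x = ((A^T *m u)^T *m x) 0 0.
  by rewrite [RHS]mxE; apply: eq_bigr => i _; rewrite [X in _ = X * _]mxE.
by rewrite trmx_mul trmxK mulmxA.
Qed.

Lemma support_lin A K u : support (body_lin A K) u = support K (A^T *m u).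
Proof.
have [x Kx [xK _]] := support_max K (A^T *m u).
apply: support_eq => [_ [y Ky <-]|]; first by rewrite dot_mulmx support_ge.
by exists (A *m x); [exists x|rewrite dot_mulmx].
Qed.

Lemma supportZ r K u : 0 <= r -> support K (r *: u) = r * support K u.
Proof.
move=> r0; have [x Kx [xK _]] := support_max K u.
apply: support_eq => [y Ky|]; first by rewrite dotZl ler_wpM2l// support_ge.
by exists x => //; rewrite dotZl xK.
Qed.

Lemma support_scale r K u : 0 <= r -> support (body_lin r%:M K) u = r * support K u.
Proof. by move=> r0; rewrite support_lin tr_scalar_mx mul_scalar_mx supportZ. Qed.

Lemma support_le_parallel K L u e : K `<=` parallel_set L e ->
  support K u <= support L u + e * enorm u.
Proof.
move=> KL; have [x /KL[y Ly xy] [<- _]] := support_max K u.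
rewrite -(subrK y x) dotDr addrC lerD ?support_ge//.
apply: le_trans (ler_norm _) (le_trans (dot_cauchy_schwarz _ _) _).
by rewrite mulrC ler_wpM2r ?enorm_ge0.
Qed.

Lemma dot_addZ r x y : dot (x + r *: y) (x + r *: y) =
  dot x x + 2 * r * dot x y + r ^+ 2 * dot y y.
Proof. by rewrite !(dotDl, dotDr, dotZl, dotZr) (dotC y x); ring. Qed.

(* The point of L nearest to x separates them. *)
Lemma parallel_support_le K L e : 0 <= e ->
  (forall u, support K u <= support L u + e * enorm u) -> K `<=` parallel_set L e.
Proof.
move=> e0 KL x Kx.
have [|p /set_mem Lp pmin] :=
    @compact_EVT_min _ R (fun y => enorm (x - y)) L (body_nonempty L) (body_compact L).
  apply: continuous_subspaceT => y.
  apply: (@continuous_comp _ _ _ (fun y => x - y) enorm); last exact: enorm_continuous.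
  by apply: continuousB; [exact: cst_continuous|exact: cvg_id].
exists p => //; pose u := x - p.
have up y : body_set L y -> dot u (y - p) <= 0.
  move=> Ly; rewrite leNgt; apply/negP => d0.
  have q0 : 0 <= dot (y - p) (y - p) by exact: dot_ge0.
  pose d := dot u (y - p); pose q := dot (y - p) (y - p).
  have h t : 0 <= t -> t <= 1 -> dot u u <= dot u u - 2 * t * d + t ^+ 2 * q.
    move=> t0 t1; have := pmin (t *: y + (1 - t) *: p).
    move=> /(_ (mem_set (body_convex t0 t1 Ly Lp))).
    have -> : x - (t *: y + (1 - t) *: p) = u + (- t) *: (y - p).
      by rewrite /u; apply/matrixP => i j; rewrite !mxE; ring.
    rewrite -ler_sqr ?nnegrE ?enorm_ge0// !sqr_enorm -/u => /le_trans; apply.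
    by rewrite dot_addZ le_eqVlt; apply/orP; left; apply/eqP; rewrite -/d -/q; ring.
  (* Moving from p towards y changes the squared distance by -2 t d + t^2 q. This t lies in (0, 1]
     and has t q < d, so the change is negative, against minimality of p. *)
  pose t := d / (d + q + 1).
  have dq : 0 < d + q + 1 by rewrite /q /d; lra.
  have tE : t * (d + q + 1) = d by rewrite divfK// gt_eqF.
  have t0 : 0 < t by rewrite divr_gt0.
  have t1 : t <= 1 by rewrite ler_pdivrMr// mul1r; rewrite /q; lra.
  by have := h t (ltW t0) t1; rewrite -/d in d0; nra.
have uL : support L u <= dot u p.
  have [y Ly [<- _]] := support_max L u; have := up _ Ly.
  by rewrite -[- p]scaleN1r dotDr dotZr mulN1r subr_le0.
have : dot u u <= e * enorm u.
  have := le_trans (support_ge u Kx) (KL u).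
  have -> : dot u x = dot u u + dot u p by rewrite -dotDr subrK.
  by lra.
rewrite -sqr_enorm expr2 -/u; have [->//|u0] := eqVneq (enorm u) 0.
by rewrite ler_pM2r// lt_neqAle eq_sym u0 enorm_ge0.
Qed.

Lemma support_inj K L : (forall u, support K u = support L u) -> K = L.
Proof.
move=> KL; have sub (K' L' : body R n) : (forall u, support K' u = support L' u) ->
    K' `<=` L'.
  move=> KL' x Kx; have KL0 u : support K' u <= support L' u + 0 * enorm u.
    by rewrite KL' mul0r addr0.
  have [y Ly xy] := parallel_support_le (lexx 0) KL0 Kx.
  by suff -> : x = y by []; apply/eqP; rewrite -subr_eq0;
    apply/eqP/enorm_eq0/le_anti; rewrite xy enorm_ge0.
by apply: body_inj; rewrite eqEsubset; split; exact: sub.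
Qed.

Lemma hausdorff_dist_support K L e : 0 <= e ->
  (forall u, `|support K u - support L u| <= e * enorm u) -> hausdorff_dist K L <= e.
Proof.
move=> e0 KL; apply: hausdorff_dist_le => //; apply: parallel_support_le => // u.
  by have := KL u; rewrite ler_norml => /andP[_]; lra.
by have := KL u; rewrite ler_norml => /andP[+ _]; lra.
Qed.

Lemma support_hausdorff_dist K L e u : hausdorff_dist K L < e ->
  `|support K u - support L u| <= e * enorm u.
Proof.
move=> /hausdorff_dist_lt[/(support_le_parallel u) h1 /(support_le_parallel u) h2].
by rewrite ler_norml; apply/andP; split; lra.
Qed.

Lemma support_continuous u : continuous (fun K => support K u).
Proof.
apply/continuous_distP => K e e0; have u1 : 0 < enorm u + 1.
  by rewrite ltr_wpDl ?enorm_ge0.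
apply/nbhs_bodyP; exists (e / (enorm u + 1)) => [|L /= KL]; first by rewrite divr_gt0.
apply: le_trans (support_hausdorff_dist u KL) _.
rewrite mulrAC ler_pdivrMr// ler_wpM2l//; first exact: ltW.
by rewrite lerDl.
Qed.

Lemma norm_support_le K u r : (forall x, body_set K x -> enorm x <= r) ->
  `|support K u| <= r * enorm u.
Proof.
move=> Kr; have [x Kx [<- _]] := support_max K u.
apply: le_trans (dot_cauchy_schwarz _ _) _; rewrite mulrC ler_wpM2r ?enorm_ge0//.
exact: Kr.
Qed.

Lemma body_norm_le K r : 0 <= r -> (forall u, support K u <= r * enorm u) ->
  forall x, body_set K x -> enorm x <= r.
Proof.
move=> r0 Kr x Kx; have := le_trans (support_ge x Kx) (Kr x).
rewrite -sqr_enorm expr2; have [->//|x0] := eqVneq (enorm x) 0.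
by rewrite ler_pM2r// lt_neqAle eq_sym x0 enorm_ge0.
Qed.

(** [K0] only serves to produce the body {0} for the empty list, as its multiple by 0. *)
Lemma body_sum (I : Type) (t : seq I) (c : I -> R) (K : I -> body R n) (K0 : body R n) :
  (forall i, 0 <= c i) ->
  exists L, forall u, support L u = \sum_(i <- t) c i * support (K i) u.
Proof.
move=> c0; elim: t => [|i t [L IHt]].
  by exists (body_lin 0%:M K0) => u; rewrite big_nil support_scale// mul0r.
exists (body_add (body_lin (c i)%:M (K i)) L) => u.
by rewrite support_add support_scale// big_cons IHt.
Qed.

Lemma enorm_mulmx A x : enorm (A *m x) <= n%:R * (n%:R * `|A|) * enorm x.
Proof.
apply: le_trans (enorm_mx_norm _) _; rewrite -!mulrA ler_wpM2l//.
apply: mx_norm_le => [|i j]; first by rewrite !mulr_ge0 ?enorm_ge0.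
rewrite mxE; apply: le_trans (ler_norm_sum _ _ _) _.
apply: (@le_trans _ _ (\sum_(k < n) `|A| * enorm x)).
  apply: ler_sum => k _; rewrite normrM ler_pM// ?mx_coord_le//.
  by rewrite (ord1 j) coord_le_enorm.
by rewrite sumr_const card_ord -[leLHS]mulr_natl.
Qed.

Lemma compact_bodies_bounded (C : set (body R n)) : compact C ->
  exists r, forall K, C K -> forall x, body_set K x -> enorm x <= r.
Proof.
move=> /compact_near_coveringP/(_ _ \oo (fun (i : nat) K => forall x, body_set K x -> enorm x <= i%:R)).
case=> [K CK|i _ /(_ i (leqnn i)) h]; last by exists i%:R.
have [s Ks] := compact_enorm_bounded (body_compact K).
have [c sc] := ex_natr_ge (s + 1).
exists ([set L | hausdorff_dist K L < 1], [set i | (c <= i)%N]) => /=.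
  by split; [apply/nbhs_bodyP; exists 1|exists c].
move=> -[L i] /= [/hausdorff_dist_lt[_ LK] ci] x /LK[y Ky xy].
rewrite -(subrK y x); apply: le_trans (enorm_triangle _ _) _.
have := Ks _ Ky; have : c%:R <= i%:R :> R by rewrite ler_nat.
by lra.
Qed.

Lemma body_lin_mulmx A (B : 'M[R]_n) K : body_lin A (body_lin B K) = body_lin (A *m B) K.
Proof.
apply: body_inj; rewrite eqEsubset; split=> [_ [_ [x Kx <-] <-]|_ [x Kx <-]].
  by exists x => //; rewrite mulmxA.
by exists (B *m x); [exists x|rewrite mulmxA].
Qed.

Lemma body_lin1 K : body_lin 1%:M K = K.
Proof.
apply: body_inj; rewrite eqEsubset; split=> [_ [x Kx <-]|x Kx]; first by rewrite mul1mx.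
by exists x; rewrite ?mul1mx.
Qed.

Lemma bodies_in_ball_radius_compact r : 0 < r ->
  compact [set K : body R n | forall x, body_set K x -> enorm x <= r].
Proof.
move=> r0; have -> : [set K : body R n | forall x, body_set K x -> enorm x <= r] =
    body_lin r%:M @` [set K : body R n | K `<=` unit_ball].
  rewrite eqEsubset; split=> [K /= Kr|_ [K K1 <-] _ [x /K1 x1 <-]].
    exists (body_lin r^-1%:M K); last first.
      by rewrite body_lin_mulmx -scalar_mxM divff ?gt_eqF// body_lin1.
    move=> _ [x /Kr xr <-] /=; rewrite /unit_ball /= mul_scalar_mx enormZ.
    by rewrite gtr0_norm ?invr_gt0// mulrC ler_pdivrMr// mul1r.
  by rewrite mul_scalar_mx enormZ gtr0_norm// ger_pMr.
apply: continuous_compact; last exact: bodies_in_ball_compact.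
exact/continuous_subspaceT/body_lin_continuous.
Qed.

(** Write A x - B y = A (x - y) + (A - B) y. The first term is small when the bodies are close, the
    second when the matrices are, because bodies within distance 1 of [K] lie in a common ball. *)
Lemma body_lin_jointly_continuous :
  continuous (fun z : 'M[R]_n * body R n => body_lin z.1 z.2).
Proof.
move=> [A K] P /nbhs_bodyP[e e0 eP] /=.
have [s Ks] := compact_enorm_bounded (body_compact K).
pose N : R := n%:R * n%:R; have N0 : 0 <= N by rewrite mulr_ge0.
pose a := N * `|A| + 1; pose b := N * (`|s| + 1) + 1.
have a0 : 0 < a by rewrite ltr_wpDl ?mulr_ge0.
have b0 : 0 < b by rewrite ltr_wpDl ?mulr_ge0.
have e20 : 0 < e / 2 by rewrite divr_gt0.
have e40 : 0 < e / 2 / 2 by rewrite divr_gt0.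
exists (ball A (Num.min 1 (e / 2 / 2 / b)), [set L | hausdorff_dist K L < Num.min 1 (e / 2 / 2 / a)]).
  split=> /=.
    by apply: nbhsx_ballx; rewrite lt_min ltr01 divr_gt0.
  by apply/nbhs_bodyP; exists (Num.min 1 (e / 2 / 2 / a)) => //; rewrite lt_min ltr01 divr_gt0.
move=> -[B L] /=; rewrite -ball_normE /= lt_min => -[/andP[_ AB]].
rewrite lt_min => /andP[KL1 KLe]; apply: eP => /=.
have [KL LK] := hausdorff_dist_lt KLe.
have [_ LK1] := hausdorff_dist_lt KL1.
have close x y : body_set K x -> body_set L y -> enorm (x - y) <= e / 2 / 2 / a ->
    enorm (A *m x - B *m y) <= e / 2.
  move=> Kx Ly xy; have -> : A *m x - B *m y = A *m (x - y) + (A - B) *m y.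
    by rewrite mulmxBr mulmxBl subrKA.
  have y1 : enorm y <= `|s| + 1.
    have [z Kz yz] := LK1 _ Ly; rewrite -(subrK z y).
    apply: le_trans (enorm_triangle _ _) _; have := Ks _ Kz; have := ler_norm s; lra.
  apply: le_trans (enorm_triangle _ _) _; rewrite (splitr (e / 2)) lerD//.
    apply: le_trans (enorm_mulmx _ _) _; rewrite mulrA -/N.
    apply: (@le_trans _ _ (a * (e / 2 / 2 / a))); last by rewrite mulrC divfK// gt_eqF.
    by rewrite ler_pM ?enorm_ge0 ?mulr_ge0// lerDl.
  apply: le_trans (enorm_mulmx _ _) _; rewrite mulrA -/N.
  apply: (@le_trans _ _ (b * (e / 2 / 2 / b))); last by rewrite mulrC divfK// gt_eqF.
  rewrite mulrAC ler_pM ?enorm_ge0 ?mulr_ge0 ?enorm_ge0 ?(ltW AB)//.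
  apply: (@le_trans _ _ (N * (`|s| + 1))); first by rewrite ler_wpM2l.
  by rewrite lerDl.
apply: (@le_lt_trans _ _ (e / 2)); last by lra.
apply: hausdorff_dist_le; first exact: ltW.
  move=> _ [x Kx <-]; have [y Ly xy] := KL _ Kx.
  by exists (B *m y); [exists y|exact: close].
move=> _ [y Ly <-]; have [x Kx xy] := LK _ Ly.
by exists (A *m x); [exists x|rewrite enormB; apply: close => //; rewrite enormB].
Qed.

End support_functions.

(** * Minkowski integrals *)

Section minkowski_integral.
Context {R : realType} {n p q : nat}.
Implicit Types (Gamma : 'M[R]_(p, q) -> body R n) (w : 'M[R]_(p, q) -> R).

Lemma test_fun_support b w Gamma u : continuous Gamma -> test_fun b w ->
  test_fun b (fun A => w A * support (Gamma A) u).
Proof.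
move=> cG tw; under eq_fun do rewrite mulrC.
apply: (test_funMl _ tw) => A.
exact: (@continuous_comp _ _ _ Gamma (fun K => support K u) A (cG A) (@support_continuous _ _ u _)).
Qed.

(** Each lattice sum is the support function of a Minkowski combination [B k] of bodies. These lie
    in one ball, so by Blaschke selection they converge along the ultrafilter, and support functions
    pass to the limit. *)
Lemma minkowski_integral b w Gamma : continuous Gamma -> test_fun b w ->
  (forall A, 0 <= w A) ->
  exists L : body R n, forall u, support L u = mxint (fun A => w A * support (Gamma A) u).
Proof.
move=> cG tw w0.
have t u := test_fun_support u cG tw.
have /choice[B BE] : forall k, exists L : body R n, forall u,
    support L u = lattice_sum k (fun A => w A * support (Gamma A) u).
  move=> k.
  have [L LE] := body_sum (index_enum {: 'M['I_(2 * (b * 2 ^ k)).+1]_(p, q)})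
    (fun z => Gamma (lattice_point k (box_point z))) (Gamma 0)
    (c := fun z => mesh k ^+ (p * q) * w (lattice_point k (box_point z)))
    (fun z => mulr_ge0 (exprn_ge0 _ (ltW (mesh_gt0 k))) (w0 _)).
  exists L => u; rewrite LE (lattice_sumE _ (proj2 (t u))) mulr_sumr.
  by apply: eq_bigr => z _; rewrite mulrA.
have [s s0 ws] := test_fun_bounded tw.
have [r Gr] : exists r, forall A : 'M[R]_(p, q), `|A| <= b%:R ->
    forall x, body_set (Gamma A) x -> enorm x <= r.
  have [r hr] : exists r, forall K, (Gamma @` [set A : 'M[R]_(p, q) | `|A| <= b%:R]) K ->
      forall x, body_set K x -> enorm x <= r.
    apply: compact_bodies_bounded; apply: continuous_compact; last exact: mx_ball_compact.
    exact: continuous_subspaceT.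
  by exists r => A Ab x; apply: hr; exists A.
pose vol := @box_volume R p q b; have vol0 : 0 < vol by exact: box_volume_gt0.
(* [vol * s] bounds the total weight in every lattice sum, and the bodies that carry weight lie in
   the ball of radius |r| + 1. *)
pose r' := vol * (s * (`|r| + 1)).
have r'0 : 0 < r' by rewrite !mulr_gt0// ltr_wpDl.
have Br k x : body_set (B k) x -> enorm x <= r'.
  apply: body_norm_le => [|u]; first exact: ltW.
  rewrite BE; apply: le_trans (ler_norm _) _; rewrite /r' -!mulrA.
  apply: (lattice_sum_bound k (proj2 (t u))) => A.
  have [Ab|bA] := leP `|A| b%:R; last first.
    by rewrite (proj2 tw)// mul0r normr0 !mulr_ge0 ?enorm_ge0// ltW// ltr_wpDl.
  rewrite normrM ler_pM//; apply: (@norm_support_le _ _ _ _ (`|r| + 1)) => y Gy.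
  by apply: le_trans (Gr _ Ab _ Gy) _; have := ler_norm r; lra.
have [L _ BL] := compact_ultra_cvg (bodies_in_ball_radius_compact r'0) Br.
exists L => u; apply/esym/(mxint_unique (t u)).
under eq_cvg do rewrite -BE.
exact: (continuous_cvg _ (@support_continuous R n u L) BL).
Qed.

End minkowski_integral.

(** * Smooth kernels and differentiation under the integral *)

Section bump.
Context {R : realType}.
Implicit Types (t s : R) (m : nat).

(** The power t^-m is included because the derivatives of exp(-1/t) are combinations of these
    functions: the family over all m is closed under differentiation up to linear combinations. *)
Definition smooth_bump m t : R := if 0 < t then t^-1 ^+ m * expR (- t^-1) else 0.

Lemma smooth_bump_ge0 m t : 0 <= smooth_bump m t.
Proof.
rewrite /smooth_bump; case: ifPn => // t0.
by rewrite mulr_ge0 ?expR_ge0// exprn_ge0// invr_ge0 ltW.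
Qed.

Lemma smooth_bump0_gt0 t : 0 < t -> 0 < smooth_bump 0 t.
Proof. by move=> t0; rewrite /smooth_bump t0 expr0 mul1r expR_gt0. Qed.

(** Compare exp(s) with the term s^(m+2) / (m+2)! of its series at s = 1/t. A quadratic bound is
    what makes the derivative at 0 exist and vanish. *)
Lemma smooth_bump_le_sqr m t : smooth_bump m t <= (m.+2)`!%:R * t ^+ 2.
Proof.
rewrite /smooth_bump; case: ifPn => [t0|_]; last by rewrite mulr_ge0 ?sqr_ge0.
have s0 : 0 < t^-1 by rewrite invr_gt0.
have h : t^-1 ^+ m.+2 / (m.+2)`!%:R <= expR t^-1.
  by apply: le_trans (expR_ge1Dxn m.+1 (ltW s0)); rewrite lerDr.
have f0 : 0 < (m.+2)`!%:R :> R by rewrite ltr0n fact_gt0.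
rewrite expRN ler_pdivrMr ?expR_gt0//.
apply: le_trans (ler_wpM2l _ h); last by rewrite mulr_ge0// sqr_ge0.
set F := (m.+2)`!%:R in f0 *; rewrite -[m.+2]addn2 exprD.
have -> : F * t ^+ 2 * (t^-1 ^+ m * t^-1 ^+ 2 / F) =
    t^-1 ^+ m * (t * t^-1) ^+ 2 * (F / F) by ring.
by rewrite !divff ?gt_eqF// expr1n !mulr1.
Qed.

Lemma is_derive_smooth_bump m t :
  is_derive t 1 (smooth_bump m) (smooth_bump m.+2 t - m%:R * smooth_bump m.+1 t).
Proof.
have [t0|t0|->] := ltgtP t 0.
- have -> : smooth_bump m.+2 t - m%:R * smooth_bump m.+1 t = 0.
    by rewrite /smooth_bump !ifN -?leNgt ?(ltW t0)// mulr0 subr0.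
  have nt : \near t, cst 0 t = smooth_bump m t.
    by near=> s; rewrite /smooth_bump ifN// -leNgt ltW//; near: s; exact: lt_nbhsl.
  exact: (near_eq_is_derive nt) (is_derive_cst _ _ _).
- have tn0 : t != 0 by rewrite gt_eqF.
  have nt : \forall s \near t, s^-1 ^+ m * expR (- s^-1) = smooth_bump m s.
    by near=> s; rewrite /smooth_bump ifT//; near: s; exact: lt_nbhsr.
  apply: (near_eq_is_derive nt); rewrite /smooth_bump t0.
  have dV : is_derive t 1 (fun s => s^-1) (- t ^- 2).
    split; first exact: derivableV.
    by rewrite (@deriveV _ _ id)// derive_id [_ *: _]mulr1.
  have dE : is_derive t 1 (fun s => expR (- s^-1)) (t ^- 2 * expR (- t^-1)).
    rewrite mulrC; have dN : is_derive t 1 (fun s => - s^-1) (t ^- 2).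
      by rewrite -[t ^- 2]opprK; exact: is_deriveN dV.
    exact: (@is_derive1_comp _ expR (fun s => - s^-1)).
  have dX := is_deriveX m dV; rewrite exprfctE in dX.
  have dM := is_deriveM dX dE; rewrite mulrfctE in dM.
  apply: is_derive_eq dM _; rewrite /= /GRing.scale /=.
  have -> : m%:R * t^-1 ^+ m.-1 * - t ^- 2 = - (m%:R * t^-1 ^+ m.+1) :> R.
    case: (m) => [|k]; first by rewrite !mul0r oppr0.
    by rewrite -exprVn [t^-1 ^+ k.+2]exprSr [t^-1 ^+ k.+1]exprSr /=; ring.
  by rewrite -exprVn -[m.+2]addn2 exprD; ring.
- have -> : smooth_bump m.+2 0 - m%:R * smooth_bump m.+1 0 = 0 by rewrite /smooth_bump ltxx mulr0 subr0.
  have cv : h^-1 *: ((smooth_bump m \o shift 0) (h *: 1) - smooth_bump m 0) @[h --> 0^'] --> 0.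
    apply/cvgrPdist_le => e e0; near=> h.
    rewrite sub0r normrN /= addr0 [_ *: 1]mulr1 {2}/smooth_bump ltxx subr0 normrM.
    rewrite (ger0_norm (smooth_bump_ge0 _ _)).
    have f0 : 0 < (m.+2)`!%:R :> R by rewrite ltr0n fact_gt0.
    apply: le_trans (ler_wpM2l _ (smooth_bump_le_sqr _ _)) _ => //.
    have hn0 : `|h| != 0 by rewrite normr_eq0; near: h; exact: nbhs_dnbhs_neq.
    have -> : `|h^-1| * ((m.+2)`!%:R * h ^+ 2) = (m.+2)`!%:R * `|h|.
      by rewrite normfV -[h ^+ 2]real_normK ?num_real//; field.
    rewrite -ler_pdivlMl//; near: h; apply: dnbhs0_le.
    by rewrite mulr_gt0// invr_gt0.
  split; first by apply/cvg_ex; exists 0.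
  by apply: cvg_lim cv.
Unshelve. all: by end_near. Qed.

End bump.

(** * Differentials and C^k calculus *)

Section frechet.
Context {R : realType} {V W : normedModType R}.
Implicit Types (f g : V -> W) (x v : V).

Lemma frechetP f x (df : V -> W) : linear df -> continuous df ->
  (forall e : R, 0 < e -> nbhs x [set y | `|f y - f x - df (y - x)| <= e * `|y - x|]) ->
  differentiable f x /\ forall v, 'D_v f x = df v.
Proof.
move=> ldf cdf h; pose dL : {linear V -> W} := HB.pack df (GRing.isLinear.Build _ _ _ _ _ ldf).
have fE : f \o shift x = cst (f x) + dL +o_ 0 id.
  apply/eqaddoP => e e0; have /nbhs_ballP[d /= d0 hd] := h e e0.
  apply/nbhs_ballP; exists d => //= y; rewrite -ball_normE /= sub0r normrN => yd.
  have := hd (y + x); rewrite /= -ball_normE /= opprD addrCA subrr addr0 normrN addrK.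
  move=> /(_ yd); rewrite -!addrA -opprD; exact.
have dE : 'd f x = dL :> (V -> W) by exact: diff_unique.
have dfx : differentiable f x by apply/diff_locallyP; rewrite dE.
by split=> // v; rewrite deriveE// dE.
Qed.

Lemma frechet_near f x : differentiable f x ->
  forall e : R, 0 < e -> nbhs x [set y | `|f y - f x - 'd f x (y - x)| <= e * `|y - x|].
Proof.
move=> /diff_locallyP[_ /eqaddoP h] e e0; have /nbhs_ballP[d /= d0 hd] := h e e0.
apply/nbhs_ballP; exists d => //= y; rewrite -ball_normE /= => yd.
have := hd (y - x); rewrite /= -ball_normE /= sub0r normrN distrC => /(_ yd).
rewrite -![(_ + _ : _ -> _) _]/(_ + _) -![(- _ : _ -> _) _]/(- _) /= subrK opprD addrA.
exact.
Qed.

Lemma near_eq_differentiable f g x : nbhs x [set y | f y = g y] ->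
  differentiable f x -> differentiable g x.
Proof.
move=> fg dfx; have fgx := nbhs_singleton fg.
have [|||//] := @frechetP g x ('d f x).
- exact: linearP.
- exact: diff_continuous.
- move=> e e0; apply: filterS2 fg (frechet_near dfx e0) => y /= <-.
  by rewrite -fgx.
Qed.

End frechet.

Section Ck.
Context {R : realType} {V : normedModType R}.
Variables (U : set V).
Hypothesis U_open : open U.
Implicit Types (W : normedModType R) (k : nat).

(** Since [U] is open, equality on [U] is equality near each of its points. Derivative formulas
    valid only on [U] may thus be substituted in the inductions on k below. *)
Lemma eq_is_Ck W k (f g : V -> W) : (forall x, U x -> f x = g x) ->
  is_Ck U k f -> is_Ck U k g.
Proof.
have nfg (f' g' : V -> W) : (forall x, U x -> f' x = g' x) ->
    forall x, U x -> nbhs x [set y | f' y = g' y].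
  by move=> fg x Ux; apply: filterS (open_nbhs_nbhs (conj U_open Ux)) => y /fg.
elim: k f g => [|k IHk] f g fg /=.
  move=> cf x Ux; have cfx : f @ x --> f x := cf x Ux.
  suff : g @ x --> f x by rewrite fg.
  apply: cvg_trans cfx; apply: near_eq_cvg.
  by apply: filterS (nfg _ _ fg x Ux) => y.
move=> [df Df]; split=> [x Ux|v].
  exact: near_eq_differentiable (nfg _ _ fg x Ux) (df x Ux).
apply: IHk (Df v) => x Ux; apply: near_eq_derive; exact: nfg.
Qed.

Lemma is_Ck_pred W k (f : V -> W) : is_Ck U k.+1 f -> is_Ck U k f.
Proof.
elim: k f => [|k IHk] f [df Df].
  by move=> x Ux; apply: differentiable_continuous; exact: df.
by split=> // v; apply: IHk; exact: Df.
Qed.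

Lemma is_CkD W k (f g : V -> W) : is_Ck U k f -> is_Ck U k g ->
  is_Ck U k (fun x => f x + g x).
Proof.
elim: k f g => [|k IHk] f g /=.
  by move=> cf cg x Ux; exact: (continuousD (cf x Ux) (cg x Ux)).
move=> [df Df] [dg Dg]; split=> [x Ux|v].
  by apply: (@differentiableD _ _ _ f g); [exact: df|exact: dg].
apply: eq_is_Ck (IHk _ _ (Df v) (Dg v)) => x Ux; apply/esym.
by apply: (@deriveD _ _ _ f g); apply: diff_derivable; [exact: df|exact: dg].
Qed.

Lemma is_Ck_cst W k (a : W) : is_Ck U k (fun=> a).
Proof.
elim: k a => [|k IHk] a /=; first by move=> x _; exact: cst_continuous.
split=> [x _|v]; first exact: differentiable_cst.
by apply: eq_is_Ck (IHk 0) => x Ux; rewrite (derive_cst a).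
Qed.

Lemma scale_is_bilinear W : bilinear_for
  (GRing.Scale.Law.clone _ _ *:%R _) (GRing.Scale.Law.clone _ _ *:%R _)
  (@GRing.scale R W).
Proof.
split=> [u'|u] a x y /=; first by rewrite scalerDl scalerA.
by rewrite scalerDr !scalerA mulrC.
Qed.

HB.instance Definition _ W :=
  bilinear_isBilinear.Build R R W W _ _ (@GRing.scale R W) (scale_is_bilinear W).

(** Leibniz' rule as the chain rule for the bilinear map (s, w) |-> s w after x |-> (c x, f x). *)
Lemma differentiable_scale W (c : V -> R) (f : V -> W) x :
  differentiable c x -> differentiable f x ->
  differentiable (fun y => c y *: f y) x /\
  forall v, 'D_v (fun y => c y *: f y) x = 'D_v c x *: f x + c x *: 'D_v f x.
Proof.
move=> dc df; have sc : continuous (fun z : R * W => z.1 *: z.2) by exact: scale_continuous.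
have ds p : differentiable (fun z : R * W => z.1 *: z.2) p by exact: differentiable_bilin.
have dp : differentiable (fun y => (c y, f y)) x by exact: differentiable_pair.
have d : differentiable (fun y => c y *: f y) x.
  exact: (differentiable_comp dp (ds (c x, f x))).
split=> // v; rewrite !deriveE//.
have -> : 'd (fun y => c y *: f y) x =
    'd (fun z : R * W => z.1 *: z.2) (c x, f x) \o 'd (fun y => (c y, f y)) x :> (V -> W).
  exact: (diff_comp dp (ds (c x, f x))).
by rewrite /= diff_bilin//= diff_pair//= addrC.
Qed.

Lemma is_CkZ W k (c : V -> R) (f : V -> W) : is_Ck U k c -> is_Ck U k f ->
  is_Ck U k (fun x => c x *: f x).
Proof.
elim: k c f => [|k IHk] c f.
  by move=> cc cf x Ux; apply: continuousZ; [exact: cc|exact: cf].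
move=> Cc Cf; have [cc Dc] := Cc; have [cf Df] := Cf; split=> [x Ux|v].
  exact: (differentiable_scale (cc x Ux) (cf x Ux)).1.
have h := is_CkD (IHk _ _ (Dc v) (is_Ck_pred Cf)) (IHk _ _ (is_Ck_pred Cc) (Df v)).
by apply: eq_is_Ck h => x Ux; rewrite (differentiable_scale (cc x Ux) (cf x Ux)).2.
Qed.

(** The derivative -c^-1 c^-1 D_v c contains only c^-1, which is C^k by induction, and D_v c. *)
Lemma is_CkV k (c : V -> R) : (forall x, U x -> c x != 0) -> is_Ck U k c ->
  is_Ck U k (fun x => (c x)^-1).
Proof.
move=> c0; elim: k => [|k IHk].
  by move=> cc x Ux; apply: continuousV; [exact: c0|exact: cc].
move=> Cc; have [cc Dc] := Cc; split=> [x Ux|v].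
  by apply: differentiableV; [exact: cc|exact: c0].
have CV := IHk (is_Ck_pred Cc).
have h := is_CkZ (is_Ck_cst k (-1 : R)) (is_CkZ CV (is_CkZ CV (Dc v))).
apply: eq_is_Ck h => x Ux; rewrite deriveV ?c0//; last exact/diff_derivable/cc.
by rewrite !scalerA mulN1r mulNr -invfM -expr2.
Qed.

Lemma is_Ck_linear W W' k (L : {linear W -> W'}) (f : V -> W) : continuous L ->
  is_Ck U k f -> is_Ck U k (L \o f).
Proof.
move=> cL; elim: k f => [|k IHk] f.
  by move=> cf x Ux; apply: continuous_comp; [exact: cf|exact: cL].
move=> [df Df]; have dL y := linear_differentiable y cL.
split=> [x Ux|v]; first by apply: differentiable_comp; [exact: df|exact: dL].
apply: eq_is_Ck (IHk _ (Df v)) => x Ux /=; have dfx := df x Ux.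
have dLf : differentiable (L \o f) x by exact: differentiable_comp (dL (f x)).
rewrite !deriveE//.
have -> : 'd (L \o f) x = 'd L (f x) \o 'd f x :> (V -> W') by exact: diff_comp.
by rewrite diff_lin.
Qed.

End Ck.

(** * Kernels with Taylor estimates uniform in a parameter *)

Section smooth_kernels.
Context {R : realType} {n : nat}.
Local Notation M := 'M[R]_n.
Implicit Types (theta : M -> M -> R) (A g v : M) (b : nat).

(* Functions of (A, g), smooth in g, stable under the differentiation in g. *)
Inductive smooth_kernel : (M -> M -> R) -> Prop :=
| kernel_param a : continuous a -> smooth_kernel (fun A _ => a A)
| kernel_coord i j : smooth_kernel (fun _ g => g i j)
| kernel_add theta eta : smooth_kernel theta -> smooth_kernel eta ->
    smooth_kernel (fun A g => theta A g + eta A g)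
| kernel_mul theta eta : smooth_kernel theta -> smooth_kernel eta ->
    smooth_kernel (fun A g => theta A g * eta A g)
| kernel_bump m theta : smooth_kernel theta ->
    smooth_kernel (fun A g => smooth_bump m (theta A g)).

Lemma kernel_cst (s : R) : smooth_kernel (fun _ _ => s).
Proof. by apply: (@kernel_param (fun=> s)) => A; exact: cst_continuous. Qed.

Lemma kernel_sum (I : Type) (r : seq I) (F : I -> M -> M -> R) :
  (forall i, smooth_kernel (F i)) ->
  smooth_kernel (fun A g => \sum_(i <- r) F i A g).
Proof.
move=> kF; elim: r => [|i r IHr].
  suff -> : (fun A g => \sum_(i <- [::]) F i A g) = fun _ _ => 0 by exact: kernel_cst.
  by apply/funext => A; apply/funext => g; rewrite big_nil.
suff -> : (fun A g => \sum_(j <- i :: r) F j A g) =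
    fun A g => F i A g + \sum_(j <- r) F j A g by exact: kernel_add.
by apply/funext => A; apply/funext => g; rewrite big_cons.
Qed.

Lemma smooth_bump_differentiable m (t : R) : differentiable (smooth_bump m) t.
Proof. by apply/derivable1_diffP; have [] := is_derive_smooth_bump m t. Qed.

Lemma kernel_continuous theta : smooth_kernel theta ->
  continuous (fun z : M * M => theta z.1 z.2).
Proof.
elim=> [a ca|i j|th et _ cth _ cet|th et _ cth _ cet|m th _ cth] z.
- by apply: (@continuous_comp _ _ _ fst a); [exact: cvg_fst|exact: ca].
- apply: (@continuous_comp _ _ _ snd (fun g : M => g i j)); first exact: cvg_snd.
  exact: coord_continuous.
- exact: (continuousD (cth z) (cet z)).
- exact: (continuousM (cth z) (cet z)).
- apply: (continuous_comp (cth z)).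
  exact/differentiable_continuous/smooth_bump_differentiable.
Qed.

Lemma kernel_differentiable theta : smooth_kernel theta ->
  forall A g, differentiable (theta A) g.
Proof.
elim=> [a ca|i j|th et _ cth _ cet|th et _ cth _ cet|m th _ cth] A g.
- exact: differentiable_cst.
- exact: differentiable_coord.
- by apply: (@differentiableD _ _ _ (th A) (et A)).
- by apply: (@differentiableM _ _ (th A) (et A)).
- apply: (differentiable_comp (cth A g)); exact: smooth_bump_differentiable.
Qed.

Lemma kernel_derive theta v : smooth_kernel theta ->
  smooth_kernel (fun A g => 'D_v (theta A) g).
Proof.
have ext (F G : M -> M -> R) : (forall A g, F A g = G A g) -> smooth_kernel G -> smooth_kernel F.
  by move=> FG; suff -> : F = G by []; apply/funext => A; apply/funext => g.
have dv th : smooth_kernel th -> forall A g, derivable (th A) g v.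
  by move=> kth A g; exact/diff_derivable/kernel_differentiable.
elim=> [a ca|i j|th et kth Dth ket Det|th et kth Dth ket Det|m th kth Dth].
- by apply: ext (kernel_cst 0) => A g; exact: derive_cst.
- apply: ext (kernel_cst (v i j)) => _ g.
  apply: lim_near_cst => //; near=> h; rewrite /= !mxE addrK scalerA.
  by rewrite mulVf ?scale1r//; near: h; exact: nbhs_dnbhs_neq.
- apply: ext (kernel_add Dth Det) => A g.
  by apply: (@deriveD _ _ _ (th A) (et A)); exact: dv.
- apply: ext (kernel_add (kernel_mul kth Det) (kernel_mul ket Dth)) => A g.
  by apply: (@deriveM _ _ (th A) (et A)); exact: dv.
- have kb := kernel_add (kernel_bump m.+2 kth)
    (kernel_mul (kernel_cst (- m%:R)) (kernel_bump m.+1 kth)).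
  apply: ext (kernel_mul Dth kb) => A g.
  have dth := kernel_differentiable kth A g.
  have db := smooth_bump_differentiable m (th A g).
  have [_ bE] := is_derive_smooth_bump m (th A g).
  rewrite !deriveE//; last exact: differentiable_comp.
  have -> : 'd (fun g => smooth_bump m (th A g)) g = 'd (smooth_bump m) (th A g) \o 'd (th A) g :> (M -> R).
    exact: (diff_comp dth db).
  rewrite /= diff1E// derive1E bE [_ *: _]/(_ * _); congr (_ * _).
  by rewrite mulNr.
Unshelve. all: by end_near. Qed.

(** Reduces estimates over all directions v to the finitely many partial derivatives. *)
Lemma derive_basis (F : M -> R) g v : differentiable F g ->
  'D_v F g = \sum_i \sum_j v i j * 'D_(delta_mx i j) F g.
Proof.
move=> dF; rewrite deriveE// {1}(matrix_sum_delta v) linear_sum.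
apply: eq_bigr => i _; rewrite linear_sum; apply: eq_bigr => j _.
by rewrite linearZ deriveE.
Qed.

Lemma derivable_along (F : M -> R) g v (t : R) :
  differentiable F (t *: v + g) ->
  is_derive t 1 (fun s => F (s *: v + g)) ('D_v F (t *: v + g)).
Proof.
move=> dF0; have dF : derivable F (t *: v + g) v by exact: diff_derivable.
have E : (fun h : R => h^-1 *: (((fun s => F (s *: v + g)) \o shift t) (h *: 1) - F (t *: v + g))) =
    (fun h => h^-1 *: ((F \o shift (t *: v + g)) (h *: v) - F (t *: v + g))).
  by apply/funext => h; rewrite /= [h *: 1]mulr1 scalerDl addrA.
by split; rewrite /derivable /derive E//; exact: dF.
Qed.

(** By the mean value theorem the increment is D_v at a point of the segment from g to g'.
    Compactness of the box makes the partial derivatives there close to those at g, uniformly in A;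
    this uniformity is what differentiation under the integral in [Val] requires. *)
Lemma kernel_taylor theta b g (e : R) : smooth_kernel theta -> 0 < e ->
  nbhs g [set g' | forall A, `|A| <= b%:R ->
    `|theta A g' - theta A g - 'D_(g' - g) (theta A) g| <= e * `|g' - g|].
Proof.
(* The n^2 partial derivatives each contribute at most |v| e / N; the added 1 keeps N positive. *)
move=> kth e0; pose N : R := n%:R * n%:R + 1.
have N0 : 0 < N by rewrite ltr_wpDl ?mulr_ge0.
have eN : 0 < e / N by rewrite divr_gt0.
pose close (ij : 'I_n * 'I_n) := [set g' | forall A, `|A| <= b%:R ->
    `|'D_(delta_mx ij.1 ij.2) (theta A) g' - 'D_(delta_mx ij.1 ij.2) (theta A) g| < e / N].
have near_ij ij : nbhs g (close ij).
  have kd := kernel_continuous (kernel_derive (delta_mx ij.1 ij.2) kth).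
  exact: (continuous_near_uniform (F := fun A => 'D_(delta_mx ij.1 ij.2) (theta A)) g
    (@mx_ball_compact R n n b%:R) kd eN).
have /nbhs_ballP[d /= d0 hd] : nbhs g [set g' | forall ij, close ij g'].
  exact: (@filter_forall _ _ close (nbhs g) _ near_ij).
have dD i j g' : `|g - g'| < d -> forall A, `|A| <= b%:R ->
    `|'D_(delta_mx i j) (theta A) g' - 'D_(delta_mx i j) (theta A) g| < e / N.
  by move=> gg'; apply: (hd g' _ (i, j)); rewrite -ball_normE.
apply/nbhs_ballP; exists d => //= g'; rewrite -ball_normE /= => gg' A Ab.
pose v := g' - g; pose f (s : R) := theta A (s *: v + g).
have dth g2 := kernel_differentiable kth A g2.
have df (t : R) : is_derive t 1 f ('D_v (theta A) (t *: v + g)).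
  exact/derivable_along/dth.
have [|c c01] := MVT (@ltr01 R) (fun t _ => df t).
  apply: continuous_subspaceT => t; apply: differentiable_continuous.
  by apply/derivable1_diffP; have [] := df t.
rewrite subr0 mulr1 /f scale1r scale0r add0r subrK => ->.
rewrite -/v !derive_basis// -sumrB.
apply: (@le_trans _ _ (\sum_(i < n) \sum_(j < n) `|v| * (e / N))).
  apply: le_trans (ler_norm_sum _ _ _) _; apply: ler_sum => i _.
  rewrite -sumrB; apply: le_trans (ler_norm_sum _ _ _) _; apply: ler_sum => j _.
  rewrite -mulrBr normrM ler_pM ?mx_coord_le// ltW// dD//.
  rewrite opprD addrCA subrr addr0 normrN normrZ.
  move: c01; rewrite in_itv /= => /andP[/ltW c0 /ltW c1].
  apply: le_lt_trans gg'; rewrite distrC ger0_norm// -[leRHS]mul1r.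
  by rewrite ler_wpM2r.
rewrite !sumr_const !card_ord -mulrnA -[leLHS]mulr_natl natrM.
have -> : n%:R * n%:R * (`|v| * (e / N)) = n%:R * n%:R * (e / N) * `|v| by ring.
rewrite ler_wpM2r// mulrA ler_pdivrMr// mulrC ler_wpM2l//; first exact: ltW.
by rewrite lerDl.
Qed.

End smooth_kernels.

Lemma linear_mx_continuous {R : realType} {p q : nat} {W : normedModType R}
    (L : {linear 'M[R]_(p, q) -> W}) : continuous L.
Proof.
pose C := \sum_i \sum_j `|L (delta_mx i j)|.
have LC v : `|L v| <= `|v| * C.
  rewrite {1}(matrix_sum_delta v) linear_sum mulr_sumr.
  apply: le_trans (ler_norm_sum _ _ _) _; apply: ler_sum => i _.
  rewrite linear_sum mulr_sumr.
  apply: le_trans (ler_norm_sum _ _ _) _; apply: ler_sum => j _.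
  by rewrite linearZ normrZ ler_wpM2r// mx_coord_le.
have C0 : 0 <= C by apply: sumr_ge0 => i _; apply: sumr_ge0.
apply/continuous_distP => x e e0; have C1 : 0 < C + 1 by rewrite ltr_wpDl.
apply/nbhs_ballP; exists (e / (C + 1)) => /=; first by rewrite divr_gt0.
move=> y; rewrite -ball_normE /= ltr_pdivlMr// => /ltW xy.
rewrite -linearB; apply: le_trans (LC _) (le_trans _ xy).
by rewrite ler_wpM2l// lerDl.
Qed.

(** * Perturbation of invertible matrices *)

Section invertible_matrices.
Context {R : realType} {n : nat}.
Local Notation M := 'M[R]_n.
Implicit Types A B g : M.

Lemma mx_norm_mulmx p q (A : 'M[R]_(p, n)) (B : 'M[R]_(n, q)) :
  `|A *m B| <= n%:R * (`|A| * `|B|).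
Proof.
apply: mx_norm_le => [|i j]; first by rewrite !mulr_ge0.
rewrite mxE; apply: le_trans (ler_norm_sum _ _ _) _.
apply: (@le_trans _ _ (\sum_(k < n) `|A| * `|B|)).
  by apply: ler_sum => k _; rewrite normrM ler_pM// mx_coord_le.
by rewrite sumr_const card_ord -[leLHS]mulr_natl.
Qed.

(** If v B = 0 with v nonzero, then s v = v (s 1 - B), whence |v| <= n |v| |s 1 - B| < |v|. The
    factor n comes from the maximum norm. *)
Lemma unitmx_near_scalar (s : R) B : `|s| = 1 -> n%:R * `|s%:M - B| < 1 -> B \in unitmx.
Proof.
move=> s1 sB; rewrite unitmxE unitfE; apply/negP => /det0P[v v0 vB].
have v1 : 0 < `|v| by rewrite normr_gt0.
have : `|v| <= n%:R * (`|v| * `|s%:M - B|).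
  have vE : `|v| = `|v *m (s%:M - B)|.
    by rewrite mulmxBr vB subr0 mul_mx_scalar normrZ s1 mul1r.
  by rewrite [leLHS]vE mx_norm_mulmx.
by rewrite mulrCA leNgt gtr_pMr// sB.
Qed.

Lemma GL_open : open (@GL R n).
Proof.
rewrite openE => g /= ug; apply/nbhs_ballP.
pose C : R := n%:R * (n%:R * `|invmx g|) + 1.
have C0 : 0 < C by rewrite ltr_wpDl ?mulr_ge0.
exists C^-1 => /=; first by rewrite invr_gt0.
move=> g'; rewrite -ball_normE /= -[C^-1]mul1r ltr_pdivlMr// => gg'.
have : invmx g *m g' \in unitmx.
  apply: (@unitmx_near_scalar 1); first by rewrite normr1.
  rewrite -(mulVmx ug) -mulmxBr; apply: le_lt_trans gg'.
  apply: (@le_trans _ _ (n%:R * (n%:R * (`|invmx g| * `|g - g'|)))).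
    by rewrite ler_wpM2l// mx_norm_mulmx.
  by rewrite !mulrA mulrC ler_wpM2l// -mulrA lerDl.
by rewrite unitmx_mul => /andP[].
Qed.

End invertible_matrices.

(** * Integrals with values in [Val] *)

Section valuation_integrals.
Context {R : realType} {n : nat}.
Local Notation M := 'M[R]_n.
Implicit Types (phi : Val R n) (a : M -> R) (A g v : M) (b : nat) (K L : body R n)
  (theta : M -> M -> R).

Lemma singleton0_is_body : is_body [set (0 : 'cV[R]_n)].
Proof.
split; [by exists 0|exact: compact_set1|].
by apply/convex_setP => x y t _ _ /= -> ->; rewrite !scaler0 addr0.
Qed.

Definition body0 : body R n := Body singleton0_is_body.

Lemma body0_unit_ball : body0 `<=` unit_ball.
Proof. by move=> x /= ->; rewrite /unit_ball /= enorm0. Qed.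

Lemma norm_val_le phi (c : R) : (forall K, K `<=` unit_ball -> `|phi K| <= c) -> `|phi| <= c.
Proof.
move=> h; rewrite val_normE; apply: ge_sup => [|_ [K KB <-]]; last exact: h.
by exists `|phi body0|, body0 => //; exact: body0_unit_ball.
Qed.

Lemma val_lin_continuous phi : continuous (fun z : M * body R n => phi (body_lin z.1 z.2)).
Proof.
have [cphi _ _] := ValP phi => z.
exact: (continuous_comp (@body_lin_jointly_continuous R n z) (cphi _)).
Qed.

(** All the bodies A K lie in one ball, and [phi] is bounded on the compact set of bodies in it. The
    constant converts bounds on scalar kernels into bounds in the norm of [Val]. *)
Lemma val_lin_bounded phi b : exists2 C, 0 < C &
  forall A K, `|A| <= b%:R -> K `<=` unit_ball -> `|phi (body_lin A K)| <= C.
Proof.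
have [cphi _ _] := ValP phi; pose r : R := n%:R * (n%:R * b%:R) + 1.
have r0 : 0 < r by rewrite ltr_wpDl ?mulr_ge0.
have /compact_bounded[C [_ hC]] : compact (phi @` [set K : body R n |
    forall x, body_set K x -> enorm x <= r]).
  apply: continuous_compact; last exact: bodies_in_ball_radius_compact.
  exact: continuous_subspaceT.
exists (`|C| + 1) => [|A K Ab K1]; first by rewrite ltr_wpDl.
apply: hC; first by rewrite (le_lt_trans (ler_norm C))// ltrDl.
exists (body_lin A K) => // _ [x /K1 x1 <-].
apply: le_trans (enorm_mulmx _ _) _.
apply: (@le_trans _ _ (n%:R * (n%:R * b%:R) * 1)); last by rewrite mulr1 lerDl.
by rewrite ler_pM ?mulr_ge0 ?enorm_ge0// ler_wpM2l// ler_wpM2l.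
Qed.

Lemma body_lin_translate A K x :
  body_lin A (body_translate K x) = body_translate (body_lin A K) (A *m x).
Proof.
apply: body_inj; rewrite eqEsubset; split=> [_ [_ [y Ky <-] <-]|_ [_ [y Ky <-] <-]].
  by exists (A *m y); [exists y|rewrite mulmxDr].
by exists (y + x); [exists y|rewrite mulmxDr].
Qed.

Lemma body_lin_setU A K L (KUL : body R n) : KUL = K `|` L :> set _ ->
  body_lin A KUL = body_lin A K `|` body_lin A L :> set _.
Proof. by move=> E; rewrite /= E image_setU. Qed.

Lemma body_lin_setI A K L (KIL : body R n) : A \in unitmx -> KIL = K `&` L :> set _ ->
  body_lin A KIL = body_lin A K `&` body_lin A L :> set _.
Proof.
move=> uA E; rewrite /= E eqEsubset; split=> [_ [x [Kx Lx] <-]|_ [[x Kx <-] [y Ly xy]]].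
  by split; exists x.
exists x => //; split=> //; suff <- : y = x by [].
by rewrite -(mulKmx uA x) -xy mulKmx.
Qed.

(** Vanishing at singular matrices lets the valuation property of K |-> phi (A K) be checked for
    injective A only, where images commute with intersections. *)
Definition GL_test_fun b a := test_fun b a /\ forall A, A \notin unitmx -> a A = 0.

Lemma test_fun_val phi b a K : test_fun b a ->
  test_fun b (fun A => a A * phi (body_lin A K)).
Proof.
move=> ta; under eq_fun do rewrite mulrC; apply: (test_funMl _ ta).
exact: (continuous_slice (F := fun A K => phi (body_lin A K)) (@val_lin_continuous phi)).1.
Qed.

Definition val_integral phi a : Val R n :=
  insubd 0 (fun K => mxint (fun A => a A * phi (body_lin A K))).

Lemma val_integralE phi b a K : GL_test_fun b a ->
  val_integral phi a K = mxint (fun A => a A * phi (body_lin A K)).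
Proof.
move=> [ta a0]; rewrite /val_integral insubdK//; apply/val_predP.
have [cphi tphi vphi] := ValP phi; split.
- apply: (@mxint_continuousT _ _ _ _ b (fun A K => a A * phi (body_lin A K))).
    move=> z; apply: (@continuousM _ _ (fun z : M * body R n => a z.1)
        (fun z => phi (body_lin z.1 z.2))); last exact: val_lin_continuous.
    by apply: (@continuous_comp _ _ _ fst a); [exact: cvg_fst|exact: ta.1].
  by move=> L; exact: (test_fun_val phi L ta).2.
- by move=> L x; congr mxint; apply/funext => A; rewrite body_lin_translate tphi.
- move=> L L' KUL KIL KULE KILE.
  have t L0 := test_fun_val phi L0 ta.
  rewrite -(mxintD (t KUL) (t KIL)) -(mxintD (t L) (t L')).
  congr mxint; apply/funext => A; rewrite -!mulrDr.
  have [uA|/a0 ->] := boolP (A \in unitmx); last by rewrite !mul0r.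
  congr (_ * _); apply: vphi; first exact: body_lin_setU.
  exact: body_lin_setI.
Qed.

Lemma GL_test_funP b (s : R) a1 a2 : GL_test_fun b a1 -> GL_test_fun b a2 ->
  GL_test_fun b (fun A => s * a1 A + a2 A).
Proof.
move=> [t1 u1] [t2 u2]; split; first exact: test_funD (test_funZ s t1) t2.
by move=> A uA; rewrite u1// u2// mulr0 addr0.
Qed.

Lemma val_integralP phi b (s : R) a1 a2 : GL_test_fun b a1 -> GL_test_fun b a2 ->
  val_integral phi (fun A => s * a1 A + a2 A) =
  s *: val_integral phi a1 + val_integral phi a2.
Proof.
move=> t1 t2; apply: val_fun_inj => K.
rewrite (val_funD (s *: val_integral phi a1)) (val_funZ s (val_integral phi a1)).
rewrite (val_integralE phi K (GL_test_funP s t1 t2)) (val_integralE phi K t1).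
rewrite (val_integralE phi K t2).
have t1K := test_fun_val phi K t1.1; have t2K := test_fun_val phi K t2.1.
rewrite -(mxintZ s t1K) -(mxintD (test_funZ s t1K) t2K).
by congr mxint; apply/funext => A; rewrite mulrDl mulrA.
Qed.

Lemma norm_val_integral phi b a (C s : R) : GL_test_fun b a ->
  (forall A K, `|A| <= b%:R -> K `<=` unit_ball -> `|phi (body_lin A K)| <= C) ->
  (forall A, `|A| <= b%:R -> `|a A| <= s) ->
  `|val_integral phi a| <= @box_volume R n n b * (s * C).
Proof.
move=> ta phiC as_; apply: norm_val_le => K K1; rewrite (val_integralE phi K ta).
apply: (mxint_bound (test_fun_val phi K ta.1)) => A Ab.
by rewrite normrM ler_pM//; [exact: as_|exact: phiC].
Qed.

(** The bound on the support is shared by a whole neighbourhood of g: outside it the kernel is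
    locally constant in g, so its derivatives vanish there too and the condition is stable under
    differentiation. *)
Definition GL_supported theta := forall g, g \in unitmx -> exists b,
  nbhs g [set g' | forall A, b%:R < `|A| \/ A \notin unitmx -> theta A g' = 0].

Lemma kernel_test_fun theta b g : smooth_kernel theta ->
  (forall A, b%:R < `|A| \/ A \notin unitmx -> theta A g = 0) ->
  GL_test_fun b (theta^~ g).
Proof.
move=> kth th0; split; last by move=> A uA; apply: th0; right.
split; first exact: (continuous_slice (kernel_continuous kth)).1.
by move=> A bA; apply: th0; left.
Qed.

Lemma GL_supported_derive_at theta b g v :
  nbhs g [set g' | forall A, b%:R < `|A| \/ A \notin unitmx -> theta A g' = 0] ->
  forall A, b%:R < `|A| \/ A \notin unitmx -> 'D_v (theta A) g = 0.
Proof.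
move=> ng A bA; rewrite -(derive_cst (0 : R) g v).
by apply: near_eq_derive; apply: filterS ng => g' /(_ A bA).
Qed.

Lemma GL_supported_derive theta v : GL_supported theta ->
  GL_supported (fun A g => 'D_v (theta A) g).
Proof.
move=> sth g ug; have [b /nbhs_interior ng] := sth g ug; exists b.
by apply: filterS ng => g' ng' A; exact: GL_supported_derive_at ng' A.
Qed.

(** By linearity in the kernel, the remainder is the [val_integral] of the Taylor remainder of
    [theta], so [kernel_taylor] bounds its norm. *)
Lemma val_integral_differentiable phi theta g : smooth_kernel theta ->
  GL_supported theta -> g \in unitmx ->
  differentiable (fun g => val_integral phi (theta^~ g)) g /\
  forall v, 'D_v (fun g => val_integral phi (theta^~ g)) g =
    val_integral phi (fun A => 'D_v (theta A) g).
Proof.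
move=> kth sth ug; have [b ng] := sth g ug.
have adm g' : (forall A, b%:R < `|A| \/ A \notin unitmx -> theta A g' = 0) ->
    GL_test_fun b (theta^~ g').
  exact: kernel_test_fun.
have admD v : GL_test_fun b (fun A => 'D_v (theta A) g).
  exact: (kernel_test_fun (kernel_derive v kth) (GL_supported_derive_at v ng)).
have admg := adm g (nbhs_singleton ng).
have dP (c : R) v w : (fun A => 'D_(c *: v + w) (theta A) g) =
    fun A => c * 'D_v (theta A) g + 'D_w (theta A) g.
  apply/funext => A; have dA := kernel_differentiable kth A g.
  by rewrite !deriveE// linearP.
have ldf : linear (fun v => val_integral phi (fun A => 'D_v (theta A) g)).
  by move=> c v w; rewrite dP (val_integralP phi c (admD v) (admD w)).
pose dL : {linear M -> Val R n} := HB.pack (fun v => val_integral phi (fun A => 'D_v (theta A) g))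
  (GRing.isLinear.Build _ _ _ _ _ ldf).
apply: (frechetP ldf) => [|e e0]; first exact: (linear_mx_continuous (L := dL)).
have [C C0 phiC] := val_lin_bounded phi b.
pose vol := @box_volume R n n b; have vol0 : 0 < vol by exact: box_volume_gt0.
(* Dividing by [vol] and [C] compensates the two factors in [norm_val_integral]. *)
have e'0 : 0 < e / vol / C by rewrite !divr_gt0.
apply: filterS2 ng (kernel_taylor b g kth e'0) => g' ng' tg' /=.
have admg' := adm g' ng'; have admd := admD (g' - g).
have adm1 := GL_test_funP (-1) admg admg'.
have -> : val_integral phi (theta^~ g') - val_integral phi (theta^~ g) -
    val_integral phi (fun A => 'D_(g' - g) (theta A) g) =
    val_integral phi (fun A => -1 * 'D_(g' - g) (theta A) g +
      (-1 * theta A g + theta A g')).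
  rewrite (val_integralP phi (-1) admd adm1) (val_integralP phi (-1) admg admg').
  by rewrite !scaleN1r addrC (addrC (- val_integral phi (theta^~ g))).
apply: le_trans (norm_val_integral (s := e / vol / C * `|g' - g|) (GL_test_funP (-1) admd adm1) phiC _) _.
  by move=> A /tg'; rewrite !mulN1r addrC (addrC (- theta A g)).
rewrite -/vol le_eqVlt; apply/orP; left; apply/eqP.
by field; rewrite !gt_eqF.
Qed.

(** A directional derivative of the integral is the integral against the differentiated kernel,
    which satisfies the same hypotheses; hence induction on k. *)
Theorem val_integral_Ck phi theta k : smooth_kernel theta -> GL_supported theta ->
  is_Ck (@GL R n) k (fun g => val_integral phi (theta^~ g)).
Proof.
elim: k theta => [|k IHk] theta kth sth.
  by move=> g ug; apply: differentiable_continuous; exact: (val_integral_differentiable phi kth sth ug).1.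
split=> [g ug|v]; first exact: (val_integral_differentiable phi kth sth ug).1.
apply: (eq_is_Ck GL_open) (IHk _ (kernel_derive v kth) (GL_supported_derive v sth)).
by move=> g ug; rewrite (val_integral_differentiable phi kth sth ug).2.
Qed.

End valuation_integrals.

(** * Averaging a Minkowski valuation *)

Section matrix_bumps.
Context {R : realType} {n : nat}.
Local Notation M := 'M[R]_n.
Implicit Types (A B Q g : M) (s d : R).

(** Unlike the maximum norm it is polynomial in the entries and invariant under orthogonal
    conjugation; by [sqr_frobenius_ge] it still controls that norm. *)
Definition sqr_frobenius A : R := \tr (A *m A^T).

Lemma sqr_frobeniusE A : sqr_frobenius A = \sum_i \sum_j A i j * A i j.
Proof.
apply: eq_bigr => i _; rewrite mxE; apply: eq_bigr => j _.
by rewrite mxE.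
Qed.

Lemma sqr_frobenius_ge A : `|A| ^+ 2 <= sqr_frobenius A.
Proof.
have F0 : 0 <= sqr_frobenius A.
  by rewrite sqr_frobeniusE; apply: sumr_ge0 => i _; apply: sumr_ge0 => j _; rewrite -expr2 sqr_ge0.
rewrite -[leRHS]sqr_sqrtr// lerXn2r ?nnegrE ?sqrtr_ge0//.
apply: mx_norm_le => [|i j]; first exact: sqrtr_ge0.
rewrite -ler_sqr ?nnegrE ?sqrtr_ge0// sqr_sqrtr// real_normK ?num_real//.
rewrite sqr_frobeniusE (bigD1 i)//= (bigD1 j)//= -expr2 -addrA lerDl.
by apply: addr_ge0; [|apply: sumr_ge0 => k _]; apply: sumr_ge0 => l _; rewrite -expr2 sqr_ge0.
Qed.

Lemma sqr_frobenius0 : sqr_frobenius 0 = 0.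
Proof. by rewrite /sqr_frobenius mul0mx mxtrace0. Qed.

Lemma sqr_frobeniusN A : sqr_frobenius (- A) = sqr_frobenius A.
Proof. by rewrite /sqr_frobenius linearN /= mulNmx mulmxN opprK. Qed.

Lemma sqr_frobenius_conj Q A : Q *m Q^T = 1%:M ->
  sqr_frobenius (Q *m A *m Q^T) = sqr_frobenius A.
Proof.
move=> QQ; have QQ' : Q^T *m Q = 1%:M by exact: mulmx1C.
rewrite /sqr_frobenius !trmx_mul trmxK !mulmxA -(mulmxA _ Q^T Q) QQ' mulmx1.
by rewrite -mulmxA mxtrace_mulC -!mulmxA (mulmxA Q^T Q) QQ' mul1mx mxtrace_mulC.
Qed.

(** The centre is a scalar matrix because conjugation fixes it; only s = 1 and s = -1 occur. *)
Definition mx_bump s d A : R := smooth_bump 0 (d ^+ 2 - sqr_frobenius (A - s%:M)).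

Lemma mx_bump_ge0 s d A : 0 <= mx_bump s d A.
Proof. exact: smooth_bump_ge0. Qed.

Lemma mx_bump_near s d A : 0 < d -> mx_bump s d A != 0 -> `|A - s%:M| <= d.
Proof.
move=> d0; rewrite /mx_bump /smooth_bump; case: ifPn => [|_]; last by rewrite eqxx.
rewrite subr_gt0 => Ad _; rewrite -ler_sqr ?nnegrE ?(ltW d0)//.
exact: le_trans (sqr_frobenius_ge _) (ltW Ad).
Qed.

Lemma mx_bump_scalar_gt0 s d : 0 < d -> 0 < mx_bump s d s%:M.
Proof. by move=> d0; apply: smooth_bump0_gt0; rewrite subrr sqr_frobenius0 subr0 exprn_gt0. Qed.

Lemma mx_bumpN s d A : mx_bump s d (- A) = mx_bump (- s) d A.
Proof.
congr (smooth_bump 0 (_ - _)); rewrite -sqr_frobeniusN; congr sqr_frobenius.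
by rewrite raddfN /= opprD !opprK.
Qed.

Lemma mx_bump_conj s d Q A : Q *m Q^T = 1%:M ->
  mx_bump s d (Q *m A *m Q^T) = mx_bump s d A.
Proof.
move=> QQ; congr (smooth_bump 0 (_ - _)).
rewrite -[RHS](sqr_frobenius_conj _ QQ); congr sqr_frobenius.
by rewrite mulmxBr mulmxBl mul_mx_scalar -scalemxAl QQ scalemx1.
Qed.

Lemma mx_bump_kernel s d : smooth_kernel (fun A g => mx_bump s d (A *m g)).
Proof.
pose entry (i j : 'I_n) A g := \sum_k A i k * g k j.
have ke i j : smooth_kernel (entry i j).
  apply: kernel_sum => k; apply: kernel_mul; last exact: kernel_coord.
  by apply: (@kernel_param _ _ (fun A => A i k)); exact: coord_continuous.
pose diff (i j : 'I_n) A g := entry i j A g + - (s *+ (i == j)).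
have kd i j : smooth_kernel (diff i j) by exact: kernel_add (ke i j) (kernel_cst _).
pose q (A g : M) := \sum_i \sum_j diff i j A g * diff i j A g.
have kq : smooth_kernel q.
  by apply: kernel_sum => i; apply: kernel_sum => j; exact: kernel_mul.
have := kernel_bump 0 (kernel_add (kernel_cst (d ^+ 2)) (kernel_mul (kernel_cst (-1)) kq)).
congr smooth_kernel; apply/funext => A; apply/funext => g.
rewrite /mx_bump mulN1r; congr (smooth_bump 0 (_ - _)); rewrite sqr_frobeniusE.
by apply: eq_bigr => i _; apply: eq_bigr => j _; rewrite !mxE.
Qed.

Lemma mx_bump_continuous s d : continuous (mx_bump s d).
Proof.
have [h _] := continuous_slice (kernel_continuous (mx_bump_kernel s d)).
suff -> : mx_bump s d = fun A => mx_bump s d (A *m 1%:M) by exact: h.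
by apply/funext => A; rewrite mulmx1.
Qed.

Lemma norm_scalar_mx_le s : `|s%:M : M| <= `|s|.
Proof.
apply: mx_norm_le => // i j; rewrite !mxE; case: eqP => //= _.
by rewrite mulr0n normr0.
Qed.

Lemma mx_bump_test_fun s d : 0 < d -> d <= 1 -> `|s| = 1 -> test_fun 2 (mx_bump s d).
Proof.
move=> d0 d1 s1; split=> [|A A2]; first exact: mx_bump_continuous.
apply/eqP; apply: contraTT A2 => /(mx_bump_near d0) Ad; rewrite -leNgt.
rewrite -(subrK s%:M A); apply: le_trans (ler_normD _ _) _.
by have := norm_scalar_mx_le s; rewrite s1; lra.
Qed.

Lemma mx_bump_unitmx s d A : 0 < d -> n%:R * d < 1 -> `|s| = 1 ->
  mx_bump s d A != 0 -> A \in unitmx.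
Proof.
move=> d0 nd s1 /(mx_bump_near d0) Ad; apply: (unitmx_near_scalar s1).
by apply: le_lt_trans nd; rewrite ler_wpM2l// distrC.
Qed.

(** A nonzero bump at A g' forces A g', hence A, to be invertible, and |A g'| <= 2. From A = (A g)
    g^-1 one gets |A| <= c (2 + n |A| |g - g'|); near g the last term is at most |A| / 2, so |A| <=
    4 c. *)
Lemma mx_bump_GL_supported s d : 0 < d -> d <= 1 -> n%:R * d < 1 -> `|s| = 1 ->
  GL_supported (fun A g => mx_bump s d (A *m g)).
Proof.
move=> d0 d1 nd s1 g ug; pose c : R := n%:R * `|invmx g|.
have c0 : 0 <= c by rewrite mulr_ge0.
have [b cb] := ex_natr_ge (4 * c); exists b.
(* Chosen so that c n |g - g'| <= 1/2 for |g - g'| < r. *)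
pose r := (2 * (n%:R * c) + 1)^-1; have r0 : 0 < r.
  by rewrite invr_gt0 ltr_wpDl ?mulr_ge0.
apply/nbhs_ballP; exists r => //= g'; rewrite -ball_normE /= => gg' A bA.
apply/eqP; apply: contraTT isT => bump0.
have := mx_bump_unitmx d0 nd s1 bump0; rewrite unitmx_mul => /andP[uA _].
case: bA => [|/negP//]; rewrite ltNge => /negP; case.
apply: le_trans cb.
have Ag' : `|A *m g'| <= 2.
  rewrite leNgt; apply/negP => /((mx_bump_test_fun d0 d1 s1).2) h.
  by rewrite h eqxx in bump0.
have Ag : `|A *m g| <= 2 + n%:R * (`|A| * `|g - g'|).
  rewrite -(subrK (A *m g') (A *m g)) -mulmxBr addrC.
  by apply: le_trans (ler_normD _ _) _; rewrite lerD// mx_norm_mulmx.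
have AE : `|A| <= c * (2 + n%:R * (`|A| * `|g - g'|)).
  rewrite -{1}(mulmxK ug A); apply: le_trans (mx_norm_mulmx _ _) _.
  have -> : n%:R * (`|A *m g| * `|invmx g|) = c * `|A *m g| by rewrite /c; ring.
  by rewrite ler_wpM2l.
have X0 : 0 <= 2 * (n%:R * c) by rewrite !mulr_ge0.
have rE : 2 * (n%:R * c) * `|g - g'| <= 1.
  apply: (@le_trans _ _ (2 * (n%:R * c) * r)); first by rewrite ler_wpM2l// ltW.
  by rewrite ler_pdivrMr ?mul1r ?lerDl// ltr_wpDl.
have A0 := normr_ge0 A.
have : c * (n%:R * (`|A| * `|g - g'|)) <= `|A| / 2.
  have -> : c * (n%:R * (`|A| * `|g - g'|)) = `|A| / 2 * (2 * (n%:R * c) * `|g - g'|) by field.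
  by rewrite ler_piMr// divr_ge0.
by lra.
Qed.

Lemma mxint_gt0_at b (f : M -> R) A0 : test_fun b f -> (forall A, 0 <= f A) ->
  0 < f A0 -> 0 < mxint f.
Proof.
move=> tf f0 fA; have [c Ac] := ex_natr_ge `|A0|.
rewrite -(mxint_shift A0 tf); apply: (mxint_gt0 (test_fun_shift Ac tf)) => //.
by rewrite add0r.
Qed.

Lemma mx_bump_mxint_gt0 s d : 0 < d -> d <= 1 -> `|s| = 1 -> 0 < mxint (mx_bump s d).
Proof.
move=> d0 d1 s1; apply: (mxint_gt0_at (A0 := s%:M) (mx_bump_test_fun d0 d1 s1)).
  by move=> A; exact: mx_bump_ge0.
exact: mx_bump_scalar_gt0.
Qed.

End matrix_bumps.

Section averages.
Context {R : realType} {p q : nat}.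
Local Notation M := 'M[R]_(p, q).
Implicit Types (w f : M -> R) (b : nat).

Lemma test_fun_weight b w f : continuous f -> test_fun b w -> test_fun b (fun A => w A * f A).
Proof. by move=> cf tw; under eq_fun do rewrite mulrC; exact: test_funMl. Qed.

Lemma mxint_weighted_le b w f1 f2 (c : R) : test_fun b w -> (forall A, 0 <= w A) ->
  mxint w = 1 -> continuous f1 -> continuous f2 ->
  (forall A, w A != 0 -> f1 A <= f2 A + c) ->
  mxint (fun A => w A * f1 A) <= mxint (fun A => w A * f2 A) + c.
Proof.
move=> tw w0 w1 cf1 cf2 f12.
have t2 := test_fun_weight cf2 tw; have tc := test_funZ c tw.
rewrite -[c in leRHS]mulr1 -w1 -(mxintZ c tw) -(mxintD t2 tc).
apply: (ler_mxint (test_fun_weight cf1 tw) (test_funD t2 tc)) => A.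
have [->|wA] := eqVneq (w A) 0; first by rewrite !mul0r mulr0 addr0.
by rewrite (mulrC c) -mulrDr ler_wpM2l// f12.
Qed.

Lemma mxint_weighted_dist b w f1 f2 (c : R) : test_fun b w -> (forall A, 0 <= w A) ->
  mxint w = 1 -> continuous f1 -> continuous f2 ->
  (forall A, w A != 0 -> `|f1 A - f2 A| <= c) ->
  `|mxint (fun A => w A * f1 A) - mxint (fun A => w A * f2 A)| <= c.
Proof.
move=> tw w0 w1 cf1 cf2 f12.
have f12' A : w A != 0 -> f1 A <= f2 A + c.
  by move/f12; rewrite ler_norml => /andP[_]; lra.
have f21 A : w A != 0 -> f2 A <= f1 A + c.
  by move/f12; rewrite ler_norml => /andP[+ _]; lra.
have := mxint_weighted_le tw w0 w1 cf1 cf2 f12'.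
have := mxint_weighted_le tw w0 w1 cf2 cf1 f21.
by rewrite ler_norml => h1 h2; apply/andP; split; lra.
Qed.

End averages.

(** * The averaged valuation and its orbit map *)

Section smooth_approximation.
Context {R : realType} {n : nat}.
Local Notation M := 'M[R]_n.
Variables (e : 'cV[R]_n) (Phi : body R n -> body R n).
Hypotheses (Phi_continuous : continuous Phi) (Phi_valuation : minkowski_valuation Phi)
  (Phi_translation : translation_invariant Phi) (Phi_orthogonal : orthogonal_equivariant Phi)
  (Phi_even : even_map Phi).
Implicit Types (A B Q g : M) (K L : body R n) (u : 'cV[R]_n).

Lemma Phi_lin_continuous : continuous (fun z : M * body R n => Phi (body_lin z.1 z.2)).
Proof.
move=> z; exact: (continuous_comp (@body_lin_jointly_continuous R n z) (@Phi_continuous _)).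
Qed.

Lemma Phi_lin_continuous_l K : continuous (fun A => Phi (body_lin A K)).
Proof. exact: (continuous_slice (F := fun A K => Phi (body_lin A K)) Phi_lin_continuous).1. Qed.

Lemma support_Phi_lin_continuous K u : continuous (fun A => support (Phi (body_lin A K)) u).
Proof.
move=> A; exact: (continuous_comp (@Phi_lin_continuous_l K A) (@support_continuous _ _ u _)).
Qed.

Lemma support_Phi_val : (fun K => support (Phi K) e) \in @val_pred R n.
Proof.
apply/val_predP; split=> [K|K x|K L KUL KIL KULE KILE].
- exact: (continuous_comp (@Phi_continuous K) (@support_continuous _ _ e _)).
- by rewrite Phi_translation.
- by rewrite -!support_add (Phi_valuation KULE KILE).
Qed.

Definition support_val : Val R n := MkVal support_Phi_val.

Section averaging.
Variable d : R.
Hypotheses (d_gt0 : 0 < d) (d_le1 : d <= 1) (nd_lt1 : n%:R * d < 1).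

Definition weight A : R := (mxint (@mx_bump R n 1 d))^-1 * mx_bump 1 d A.

Let bump_gt0 : 0 < mxint (@mx_bump R n 1 d).
Proof. by apply: mx_bump_mxint_gt0; rewrite ?normr1. Qed.

Lemma weight_test_fun : test_fun 2 weight.
Proof. by apply: test_funZ; apply: mx_bump_test_fun; rewrite ?normr1. Qed.

Lemma weight_ge0 A : 0 <= weight A.
Proof. by rewrite mulr_ge0 ?mx_bump_ge0// invr_ge0 ltW. Qed.

Lemma mxint_weight : mxint weight = 1.
Proof.
have tb : test_fun 2 (@mx_bump R n 1 d) by apply: mx_bump_test_fun; rewrite ?normr1.
by rewrite (mxintZ _ tb) mulVf// gt_eqF.
Qed.

Lemma weight_bump A : weight A != 0 -> mx_bump 1 d A != 0.
Proof. by apply: contra_neq; rewrite /weight => ->; rewrite mulr0. Qed.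

Lemma weight_near A : weight A != 0 -> `|A - 1%:M| <= d.
Proof. by move/weight_bump; exact: mx_bump_near. Qed.

Lemma weight_unitmx A : A \notin unitmx -> weight A = 0.
Proof.
move=> uA; apply/eqP; apply: contraNT uA => /weight_bump.
by apply: mx_bump_unitmx; rewrite ?normr1.
Qed.

Lemma weight_test_support K u : test_fun 2 (fun A => weight A * support (Phi (body_lin A K)) u).
Proof. exact: test_fun_weight (@support_Phi_lin_continuous K u) weight_test_fun. Qed.

Lemma averaged_exists : exists Psi : body R n -> body R n, forall K u,
  support (Psi K) u = mxint (fun A => weight A * support (Phi (body_lin A K)) u).
Proof.
suff /choice[Psi PsiE] : forall K, exists L : body R n, forall u,
    support L u = mxint (fun A => weight A * support (Phi (body_lin A K)) u).
  by exists Psi.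
move=> K; apply: (minkowski_integral _ weight_test_fun weight_ge0).
exact: Phi_lin_continuous_l.
Qed.

(** The body is determined by its support function, so every property below is checked through
    [support_averaged], with [support_inj] for equalities. *)
Definition averaged : body R n -> body R n := projT1 (cid averaged_exists).

Lemma support_averaged K u :
  support (averaged K) u = mxint (fun A => weight A * support (Phi (body_lin A K)) u).
Proof. by rewrite /averaged; case: cid => /= Psi ->. Qed.

Lemma averaged_close K L (r : R) :
  (forall A, weight A != 0 -> hausdorff_dist (Phi (body_lin A K)) (Phi (body_lin A L)) < r) ->
  0 <= r -> hausdorff_dist (averaged K) (averaged L) <= r.
Proof.
move=> KL r0; apply: hausdorff_dist_support => // u; rewrite !support_averaged.
have cK K' := @support_Phi_lin_continuous K' u.
apply: (mxint_weighted_dist weight_test_fun weight_ge0 mxint_weight) => // A.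
by move/KL; exact: support_hausdorff_dist.
Qed.

Lemma averaged_approx K (r : R) :
  (forall A, weight A != 0 -> hausdorff_dist (Phi K) (Phi (body_lin A K)) < r) ->
  0 <= r -> hausdorff_dist (Phi K) (averaged K) <= r.
Proof.
move=> KL r0; apply: hausdorff_dist_support => // u; rewrite support_averaged.
have cK K' := @support_Phi_lin_continuous K' u.
have cc : continuous (fun _ : M => support (Phi K) u) by exact: cst_continuous.
have E : support (Phi K) u = mxint (fun A => weight A * support (Phi K) u).
  under eq_fun do rewrite mulrC.
  by rewrite (mxintZ _ weight_test_fun) mxint_weight mulr1.
rewrite E; apply: (mxint_weighted_dist weight_test_fun weight_ge0 mxint_weight) => // A.
by move/KL; exact: support_hausdorff_dist.
Qed.

(** [weight] lives on |A| <= 2, a compact set over which Phi (A L) tends to Phi (A K) uniformly;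
    averaging with total mass 1 keeps the bound. *)
Lemma averaged_continuous : continuous averaged.
Proof.
move=> K P /nbhs_bodyP[r r0 rP]; have r20 : 0 < r / 2 by rewrite divr_gt0.
have := near_uniform_ball (F := fun A L => Phi (body_lin A L)) K
  (@mx_ball_compact R n n 2) Phi_lin_continuous r20.
apply: filterS => L AL; apply: rP => /=.
apply: (@le_lt_trans _ _ (r / 2)); last by lra.
apply: averaged_close => [A wA|]; last exact: ltW.
have := AL A; rewrite /= ballEmdist; apply.
by rewrite leNgt; apply/negP => /(weight_test_fun.2); apply/eqP.
Qed.

Lemma averaged_translation : translation_invariant averaged.
Proof.
move=> K x; apply: support_inj => u; rewrite !support_averaged.
by congr mxint; apply/funext => A; rewrite body_lin_translate Phi_translation.
Qed.

Lemma averaged_even : even_map averaged.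
Proof.
move=> K; apply: support_inj => u; rewrite !support_averaged.
congr mxint; apply/funext => A.
have -> : body_lin A (body_opp K) = body_opp (body_lin A K).
  apply: body_inj; rewrite eqEsubset; split=> [_ [_ [x Kx <-] <-]|_ [_ [x Kx <-] <-]].
    by exists (A *m x); [exists x|rewrite mulmxN].
  by exists (- x); [exists x|rewrite mulmxN].
by rewrite Phi_even.
Qed.

Lemma averaged_valuation : minkowski_valuation averaged.
Proof.
move=> K L KUL KIL KULE KILE; apply: support_inj => u.
rewrite !support_add !support_averaged.
have t K' := weight_test_support K' u.
rewrite -(mxintD (t KUL) (t KIL)) -(mxintD (t K) (t L)).
congr mxint; apply/funext => A; rewrite -!mulrDr.
have [uA|/weight_unitmx ->] := boolP (A \in unitmx); last by rewrite !mul0r.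
congr (_ * _); rewrite -!support_add; congr support.
by apply: Phi_valuation; [exact: body_lin_setU|exact: body_lin_setI].
Qed.

(* Symmetrizing the bump makes it even, as [mxint_linear_change] requires. *)
Definition even_bump A : R := mx_bump 1 d A + mx_bump (-1) d A.

Lemma even_bump_test_fun : test_fun 2 even_bump.
Proof. by apply: test_funD; apply: mx_bump_test_fun; rewrite ?normrN ?normr1. Qed.

Lemma even_bumpN A : even_bump (- A) = even_bump A.
Proof.
rewrite /even_bump addrC; congr (_ + _); last exact: mx_bumpN.
by apply: (etrans (mx_bumpN _ _ _)); congr mx_bump; exact: opprK.
Qed.

Lemma even_bump_ge0 A : 0 <= even_bump A.
Proof. by rewrite addr_ge0 ?mx_bump_ge0. Qed.

Lemma even_bump1_gt0 : 0 < even_bump 1%:M.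
Proof. by rewrite ltr_pwDl ?mx_bump_ge0 ?mx_bump_scalar_gt0. Qed.

(** Substitute Q A Q^T for A. The factor of proportionality is 1 because [even_bump] is itself
    invariant under this substitution and has nonzero integral. Then Q A Q^T Q K = Q (A K), and
    equivariance of [Phi] moves Q to the argument u. *)
Lemma averaged_orthogonal : orthogonal_equivariant averaged.
Proof.
move=> Q K QQ; have QQ' : Q^T *m Q = 1%:M by exact: mulmx1C.
apply: support_inj => u; rewrite support_lin !support_averaged.
pose T A := Q *m A *m Q^T; pose T' A := Q^T *m A *m Q.
have cmul (P S : M) : continuous (fun A : M => P *m A *m S).
  pose L : {linear M -> M} := mulmxr S \o mulmx P.
  exact: (linear_mx_continuous (L := L)).
have TK : cancel T T' by move=> A; rewrite /T /T' !mulmxA QQ' mul1mx -mulmxA QQ' mulmx1.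
have T'K : cancel T' T by move=> A; rewrite /T /T' !mulmxA QQ mul1mx -mulmxA QQ mulmx1.
have TD : {morph T : x y / x + y} by move=> x y; rewrite /T mulmxDr mulmxDl.
have := mxint_linear_change (cmul _ _) (cmul _ _) TK T'K TD
  (weight_test_support (body_lin Q K) u) even_bump_test_fun even_bumpN.
have -> : even_bump \o T = even_bump.
  by apply/funext => A; rewrite /= /even_bump /T !mx_bump_conj.
have h0 : mxint even_bump != 0.
  rewrite gt_eqF//; apply: (mxint_gt0_at even_bump_test_fun even_bump_ge0 even_bump1_gt0).
rewrite mulrC => /(mulfI h0) <-; congr mxint; apply/funext => A /=.
rewrite /weight /T mx_bump_conj// body_lin_mulmx -mulmxA QQ' mulmx1 -body_lin_mulmx.
by rewrite Phi_orthogonal// support_lin.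
Qed.

Definition averaged_val : Val R n := val_integral support_val weight.

Lemma weight_GL_test_fun : GL_test_fun 2 weight.
Proof. by split; [exact: weight_test_fun|exact: weight_unitmx]. Qed.

Lemma averaged_valE K : averaged_val K = support (averaged K) e.
Proof. by rewrite (val_integralE _ _ weight_GL_test_fun) support_averaged. Qed.

Let one_val_pred : (fun _ : body R n => 1 : R) \in @val_pred R n.
Proof. by apply/val_predP; split=> // K; exact: cst_continuous. Qed.

Let one_val : Val R n := MkVal one_val_pred.

Lemma even_bump_kernel : smooth_kernel (fun A g => even_bump (A *m g)).
Proof. by apply: kernel_add; exact: mx_bump_kernel. Qed.

Lemma even_bump_GL_supported : GL_supported (fun A g => even_bump (A *m g)).
Proof.
move=> g ug; have [b1 h1] := mx_bump_GL_supported d_gt0 d_le1 nd_lt1 (@normr1 R) ug.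
have m1 : `|-1| = 1 :> R by rewrite normrN normr1.
have [b2 h2] := mx_bump_GL_supported d_gt0 d_le1 nd_lt1 m1 ug.
exists (b1 + b2)%N; apply: filterS2 h1 h2 => g' h1 h2 A bA.
rewrite /even_bump h1 ?h2 ?addr0//; case: bA => [bA|]; by [right|left; apply: le_lt_trans bA;
  rewrite ler_nat ?leq_addl ?leq_addr].
Qed.

Lemma weight_GL_supported : GL_supported (fun A g => weight (A *m g)).
Proof.
move=> g ug; have [b h] := mx_bump_GL_supported d_gt0 d_le1 nd_lt1 (@normr1 R) ug.
by exists b; apply: filterS h => g' h A bA; rewrite /weight h// mulr0.
Qed.

Lemma weight_kernel : smooth_kernel (fun A g => weight (A *m g)).
Proof. by apply: kernel_mul; [exact: kernel_cst|exact: mx_bump_kernel]. Qed.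

(** This scalar integral is the value at [body0] of the [val_integral] of the constant valuation 1,
    and evaluation at a body in the unit ball is a continuous linear functional on [Val]. *)
Lemma even_bump_integral_Ck k :
  is_Ck (@GL R n) k (fun g => mxint (fun A => even_bump (A *m g))).
Proof.
have lev : linear (fun f : Val R n => f body0) by move=> s f h.
pose ev : {linear Val R n -> R} := HB.pack (fun f : Val R n => f body0)
  (GRing.isLinear.Build _ _ _ _ _ lev).
have cev : continuous ev.
  apply/continuous_distP => f r r0; apply/nbhs_ballP; exists r => //= h.
  rewrite -ball_normE /= => /ltW; apply: le_trans; rewrite val_normE.
  exact: (val_norm_bound (f - h) body0_unit_ball).
have := is_Ck_linear (L := ev) GL_open cev
  (val_integral_Ck one_val k even_bump_kernel even_bump_GL_supported).
apply: (eq_is_Ck GL_open) => g ug /=.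
have [b /nbhs_singleton h] := even_bump_GL_supported ug.
rewrite (val_integralE _ _ (kernel_test_fun even_bump_kernel h)).
by congr mxint; apply/funext => A; rewrite mulr1.
Qed.

(** Substituting A g for A turns weight(A) phi(A g^-1 K) into weight(A g) phi(A K), so g leaves the
    argument of the valuation. The two integrals of [even_bump] form the scalar factor of
    [mxint_linear_change]. *)
Lemma gl_translate_averaged g : g \in unitmx ->
  gl_translate averaged_val g = (mxint (fun A => even_bump (A *m g)))^-1 *:
    (mxint even_bump *: val_integral support_val (fun A => weight (A *m g))).
Proof.
move=> ug; apply: val_fun_inj => K; rewrite gl_translateE//.
have [b /nbhs_singleton h] := weight_GL_supported ug.
have tw := kernel_test_fun weight_kernel h.
have E1 := val_integralE support_val (body_lin (invmx g) K) weight_GL_test_fun.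
have E2 := val_integralE support_val K tw.
transitivity ((mxint (fun A => even_bump (A *m g)))^-1 *
  (mxint even_bump * mxint (fun A => weight (A *m g) * support_val (body_lin A K))));
  last by congr (_ * (_ * _)); exact: (esym E2).
apply: (etrans E1).
pose T A := A *m g; pose T' A := A *m invmx g.
have cmul (S : M) : continuous (fun A : M => A *m S).
  exact: (linear_mx_continuous (L := mulmxr S)).
have TK : cancel T T' by move=> A; exact: mulmxK.
have T'K : cancel T' T by move=> A; exact: mulmxKV.
have TD : {morph T : x y / x + y} by move=> x y; rewrite /T mulmxDl.
have := mxint_linear_change (cmul _) (cmul _) TK T'K TD
  (test_fun_val support_val (body_lin (invmx g) K) weight_test_fun)
  even_bump_test_fun even_bumpN.
(* The integrand is positive at A = g^-1, where A g = 1. *)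
have c0 : mxint (even_bump \o T) != 0.
  have [b' /nbhs_singleton h'] := even_bump_GL_supported ug.
  rewrite gt_eqF//; apply: (mxint_gt0_at (A0 := invmx g) (kernel_test_fun even_bump_kernel h').1).
    by move=> A; exact: even_bump_ge0.
  by rewrite mulVmx// even_bump1_gt0.
move=> E; apply: (mulfI c0); rewrite -E mulVKf// mulrC; congr (_ * mxint _).
by apply/funext => A; rewrite /= /T body_lin_mulmx mulmxK.
Qed.

Lemma averaged_smooth : smooth_minkowski_valuation e averaged.
Proof.
exists averaged_val; first exact: averaged_valE.
move=> k; have c0 g : GL g -> mxint (fun A => even_bump (A *m g)) != 0.
  move=> ug; have [b' /nbhs_singleton h'] := even_bump_GL_supported ug.
  rewrite gt_eqF//; apply: (mxint_gt0_at (A0 := invmx g) (kernel_test_fun even_bump_kernel h').1).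
    by move=> A; exact: even_bump_ge0.
  by rewrite mulVmx// even_bump1_gt0.
have := is_CkZ GL_open (is_CkV GL_open c0 (even_bump_integral_Ck k))
  (is_CkZ GL_open (is_Ck_cst GL_open k (mxint even_bump))
    (val_integral_Ck support_val k weight_kernel weight_GL_supported)).
by apply: (eq_is_Ck GL_open) => g ug; rewrite gl_translate_averaged.
Qed.

End averaging.

End smooth_approximation.

Theorem theorem1p2 (R : realType) (n : nat) (n_ge3 : (3 <= n)%N)
    (e : 'cV[R]_n) (e_sphere : enorm e = 1) (Phi : body R n -> body R n) :
  continuous Phi -> minkowski_valuation Phi -> translation_invariant Phi ->
  orthogonal_equivariant Phi -> even_map Phi ->
  exists Phi_ : nat -> body R n -> body R n,
    (forall m : nat,
      [/\ continuous (Phi_ m), minkowski_valuation (Phi_ m),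
          translation_invariant (Phi_ m) & orthogonal_equivariant (Phi_ m)] /\
      smooth_minkowski_valuation e (Phi_ m) /\ even_map (Phi_ m)) /\
    (forall C : set (body R n), compact C -> {uniform C, Phi_ @ \oo --> Phi}).
Proof.
move=> cPhi vPhi tPhi oPhi evPhi.
(* The factor 1/(n+1) secures n d < 1, hence invertibility on the support of the weight; 1/(m+1)
   shrinks the support to the identity. *)
pose d (m : nat) : R := (n.+1)%:R^-1 * (m.+1)%:R^-1.
have d_gt0 m : 0 < d m by rewrite mulr_gt0 ?invr_gt0.
have m_le1 m : (m.+1)%:R^-1 <= 1 :> R by rewrite invf_le1// ler1n.
have d_le1 m : d m <= 1 by rewrite mulr_ile1// invr_ge0.
have nd_lt1 m : n%:R * d m < 1.
  apply: (@le_lt_trans _ _ (n%:R * (n.+1)%:R^-1)).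
    by rewrite ler_wpM2l// ler_piMr.
  by rewrite ltr_pdivrMr// mul1r ltr_nat.
exists (fun m => averaged cPhi (d_gt0 m) (d_le1 m)); split=> [m|C cC].
  split; [split|split].
  - exact: averaged_continuous.
  - exact: averaged_valuation.
  - exact: averaged_translation.
  - exact: averaged_orthogonal.
  - exact: averaged_smooth.
  - exact: averaged_even.
move=> P /uniform_nbhs[E [entE EP]].
move: entE; rewrite -entourage_ballE => -[r /= r0 rE].
have r20 : 0 < r / 2 by rewrite divr_gt0.
have cF : continuous (fun z : body R n * 'M[R]_n => Phi (body_lin z.2 z.1)).
  move=> z; apply: (@continuous_comp _ _ _ (fun z : body R n * 'M[R]_n => (z.2, z.1))
    (fun z => Phi (body_lin z.1 z.2))); last exact: Phi_lin_continuous.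
  exact: swap_continuous.
(* Here the compact set is [C] and the parameter is the matrix: for A near 1, Phi (A K) is within
   r/2 of Phi K for all K in [C] at once. *)
have := near_uniform_ball (F := fun K A => Phi (body_lin A K)) (1%:M : 'M[R]_n) cC cF r20.
move=> /nbhs_ballP[s /= s0 sF].
have d_small : \forall m \near \oo, d m < s.
  have /cvgrPdist_lt/(_ _ s0) := @cvg_harmonic R.
  apply: filterS => m; rewrite sub0r normrN ger0_norm ?invr_ge0// => hm.
  by apply: le_lt_trans hm; rewrite ler_piMl ?invr_ge0// invf_le1// ler1n.
apply: filterS d_small => m dm; apply: EP => K CK; apply: rE => /=.
rewrite ballEmdist; apply: (@le_lt_trans _ _ (r / 2)); last by lra.
apply: averaged_approx => [A wA|]; last exact: ltW.
have /sF/(_ K CK) : ball (1%:M : 'M[R]_n) s A.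
  rewrite -ball_normE /= distrC.
  exact: le_lt_trans (weight_near (d_gt0 m) wA) dm.
by rewrite body_lin1 ballEmdist.
Qed.
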